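(* For every $r\ge0$, the restriction of $\eta_r:\mathcal U(\widehat{\mathfrak{gl}}_n)\to S_{r,\mathbb Q}$ to $\mathcal U_{\mathbb Z}$ gives a surjective $\mathbb Z$-algebra homomorphism $\eta_r:\mathcal U_{\mathbb Z}\to S_{r,\mathbb Z}$.
   Context: NOTATION. Fix an integer $n\ge 2$; $\mathbb N=\{0,1,2,\dots\}$; $\upsilon$ is an indeterminate; $\mathcal Z=\mathbb Z[\upsilon,\upsilon^{-1}]$; $\mathbb Q$ and $\mathbb Z$ are $\mathcal Z$-modules by specializing $\upsilon$ to $1$. $\mathbb Z_\triangle^n$ is the set of integer sequences $\lambda=(\lambda_i)_{i\in\mathbb Z}$ with $\lambda_i=\lambda_{i-n}$; $\mathbb N_\triangle^n$ is the subset with all entries $\ge 0$. Put $\langle\lambda,\mu\rangle=\sum_{i=1}^n\lambda_i\mu_i-\sum_{i=1}^n\lambda_i\mu_{i+1}$. $\Theta_\triangle(n)$ is the set of matrices $A=(a_{i,j})_{i,j\in\mathbb Z}$ with $a_{i,j}\in\mathbb N$, $a_{i,j}=a_{i+n,j+n}$, and finitely many nonzero entries in each row and column. $\Theta^+_\triangle(n)=\{A\in\Theta_\triangle(n): a_{i,j}=0\text{ for }i\ge j\}$. $E^\triangle_{i,j}\in\Theta_\triangle(n)$ has entries $1$ at positions $(i+sn,j+sn)$, $s\in\mathbb Z$, and $0$ elsewhere. HALL ALGEBRAS. Consider the cyclic quiver with vertex set $\mathbb Z/n\mathbb Z$ and arrows $i\to i+1$. Over a field $\mathbb F$, $S_i$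 is the simple representation with $\mathbb F$ at vertex $i$ and $0$ elsewhere, $M^{i,j}$ ($i<j$) is the unique indecomposable representation of length $j-i$ with top $S_i$, and for $A\in\Theta_\triangle^+(n)$, $M_{\mathbb F}(A)=\bigoplus_{1\le i\le n,\,i<j}a_{i,j}M^{i,j}$, with dimension vector $\mathbf d(A)=(\sum_{s\le i<t}a_{s,t})_{i\in\mathbb Z}$. For $A,B,C\in\Theta^+_\triangle(n)$ the Hall polynomial $\varphi^C_{A,B}\in\mathbb Z[\upsilon^2]$ satisfies: for every finite field $\mathbb F_q$, $\varphi^C_{A,B}|_{\upsilon^2=q}$ is the number of submodules $N\subseteq M_{\mathbb F_q}(C)$ with $N\cong M_{\mathbb F_q}(B)$ and $M_{\mathbb F_q}(C)/N\cong M_{\mathbb F_q}(A)$. $D^+$ (resp. $D^-$) is the $\mathcal Z$-algebra with $\mathcal Z$-basis $u_A^+$ (resp. $u_A^-$), $A\in\Theta^+_\triangle(n)$, and product $u_A^+u_B^+=\sum_C\upsilon^{\langle\mathbf d(A),\mathbf d(B)\rangle}\varphi^C_{A,B}u_C^+$ (resp. $u_A^-u_B^-=\sum_C\upsilon^{\langle\mathbf d(B),\mathbf d(A)\rangle}\varphi^C_{B,A}u_C^-$). Put $D^\pm_{\mathbb Q}=D^\pm\otimes_{\mathcal Z}\mathbb Q$, $u_{A,1}^\pm=u_A^\pm\otimes1$. LOOP ALGEBRA AND INTEGRAL FORM. $\widehat{\mathfrak{gl}}_n=\mathfrak{gl}_n(\mathbb Q)\otimes\mathbb Q[t,t^{-1}]$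 is identified with the Lie algebra (under commutator) of matrices $(a_{i,j})_{i,j\in\mathbb Z}$ over $\mathbb Q$ with $a_{i,j}=a_{i+n,j+n}$ and finitely many nonzero entries in each row and column, via $E^\triangle_{i,j+ln}\leftrightarrow E_{i,j}\otimes t^l$ ($1\le i,j\le n$, $l\in\mathbb Z$). $\mathcal U(\widehat{\mathfrak{gl}}_n)$ is its universal enveloping algebra over $\mathbb Q$. It is known that there are unique injective algebra homomorphisms $\theta^\pm:D^\pm_{\mathbb Q}\to\mathcal U(\widehat{\mathfrak{gl}}_n)$ with $\theta^+(u^+_{E^\triangle_{i,j},1})=E^\triangle_{i,j}$, $\theta^-(u^-_{E^\triangle_{i,j},1})=E^\triangle_{j,i}$ for all $i<j$. Put $w_A^\pm=\theta^\pm(u_{A,1}^\pm)$, $\binom{E^\triangle_{i,i}}{m}=E^\triangle_{i,i}(E^\triangle_{i,i}-1)\cdots(E^\triangle_{i,i}-m+1)/m!$, and $$\mathcal U_{\mathbb Z}=\operatorname{span}_{\mathbb Z}\Big\{w_A^+\prod_{i=1}^n\binom{E^\triangle_{i,i}}{\lambda_i}w_B^-: A,B\in\Theta_\triangle^+(n),\ \lambda\in\mathbb N^n_\triangle\Big\},$$ which is a $\mathbb Z$-subalgebra of $\mathcal U(\widehat{\mathfrak{gl}}_n)$. AFFINE SCHUR ALGEBRA. For $A\in\Theta_\triangle(n)$ let $\sigma(A)=\sum_{1\le i\le n,\,j\in\mathbb Z}a_{i,j}$; $\Theta_\triangle(n,r)=\{A\in\Theta_\triangle(n):\sigma(A)=r\}$;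 $\Lambda_\triangle(n,r)=\{\lambda\in\mathbb N^n_\triangle:\sum_{i=1}^n\lambda_i=r\}$; $\operatorname{diag}(\lambda)=\sum_{i=1}^n\lambda_iE^\triangle_{i,i}$. For a finite field $\mathbb F_q$ let $V$ be a free $\mathbb F_q[\epsilon,\epsilon^{-1}]$-module of rank $r$ and $\mathcal F$ the set of sequences $L=(L_i)_{i\in\mathbb Z}$ of lattices in $V$ (free $\mathbb F_q[\epsilon]$-submodules of rank $r$ generating $V$ over $\mathbb F_q[\epsilon,\epsilon^{-1}]$) with $L_{i-1}\subseteq L_i$, $L_{i-n}=\epsilon L_i$. To $(L,L')\in\mathcal F^2$ attach $A(L,L')\in\Theta_\triangle(n,r)$ with entries $a_{i,j}=\dim_{\mathbb F_q}(L_i\cap L'_j)/(L_{i-1}\cap L'_j+L_i\cap L'_{j-1})$. For $A,B,C\in\Theta_\triangle(n,r)$ there is a polynomial $p_{A,B,C}$ in $\upsilon^2$ such that for all $q$ and all $(L,L'')$ with $A(L,L'')=C$, $p_{A,B,C}|_{\upsilon^2=q}=\#\{L'\in\mathcal F: A(L,L')=A,\ A(L',L'')=B\}$. $\mathbf S_r$ is the $\mathbb Q(\upsilon)$-algebra with basis $e_A$ ($A\in\Theta_\triangle(n,r)$) and product $e_Ae_B=\sum_Cp_{A,B,C}e_C$; put $[A]=\upsilon^{-d_A}e_A$, $d_A=\sum_{1\le i\le n,\ i\ge k,\ j<l}a_{i,j}a_{k,l}$. $S_r$ is the $\mathcal Z$-span of the $[A]$, a $\mathcal Z$-subalgebra;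 $S_{r,\mathbb Q}=S_r\otimes_{\mathcal Z}\mathbb Q$ and $S_{r,\mathbb Z}=S_r\otimes_{\mathcal Z}\mathbb Z\subseteq S_{r,\mathbb Q}$. For $A\in\Theta_\triangle(n)$ with zero diagonal, $A(\mathbf 0,r)=\sum_{\lambda\in\Lambda_\triangle(n,r-\sigma(A))}[A+\operatorname{diag}(\lambda)]$ if $\sigma(A)\le r$ and $0$ otherwise; $A(\mathbf 0,r)_1=A(\mathbf 0,r)\otimes1$, $[\operatorname{diag}(\lambda)]_1=[\operatorname{diag}(\lambda)]\otimes1$. THE MAP. $\eta_r:\mathcal U(\widehat{\mathfrak{gl}}_n)\to S_{r,\mathbb Q}$ is the (known, surjective) algebra homomorphism with $\eta_r(E^\triangle_{i,j})=E^\triangle_{i,j}(\mathbf 0,r)_1$ when $E^\triangle_{i,j}$ has $i\ne j$, and $\eta_r(E^\triangle_{i,i})=\sum_{\lambda\in\Lambda_\triangle(n,r)}\lambda_i[\operatorname{diag}(\lambda)]_1$; it is also known that $\eta_r(w_A^+)=A(\mathbf 0,r)_1$ and $\eta_r(w_A^-)=({}^tA)(\mathbf 0,r)_1$ for $A\in\Theta^+_\triangle(n)$, ${}^tA$ being the transpose. *)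

(* Defs.v *)
From HB Require Import structures.
From mathcomp Require Import all_boot all_order all_algebra.
From mathcomp Require Import finmap all_classical.

Set Implicit Arguments.
Unset Strict Implicit.
Unset Printing Implicit Defensive.

Import Order.TTheory GRing.Theory Num.Theory.

Local Open Scope classical_set_scope.
Local Open Scope ring_scope.

Definition has_card (T : Type) (S : set T) (k : nat) : Prop := (S #= `I_k)%card.

(* [\sum_(i \in P) F i] is 0 by convention when F has infinite support on P; all
   the sums over infinite index sets in this file have finite support. *)
Definition spans (R : nzRingType) (M : lmodType R) (I : choiceType)
    (P : set I) (b : I -> M) : Prop :=
  forall x : M, exists2 c : I -> R,
    finite_set (P `&` [set i | c i != 0]) & x = \sum_(i \in P) c i *: b i.

Definition lin_indep (R : nzRingType) (M : lmodType R) (I : choiceType)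
    (P : set I) (b : I -> M) : Prop :=
  forall c : I -> R, finite_set (P `&` [set i | c i != 0]) ->
    \sum_(i \in P) c i *: b i = 0 -> forall i, P i -> c i = 0.

Definition is_basis (R : nzRingType) (M : lmodType R) (I : choiceType)
    (P : set I) (b : I -> M) : Prop :=
  spans P b /\ lin_indep P b.

Definition zspan (M : zmodType) (G : set M) : set M :=
  [set x | exists (m : nat) (c : 'I_m -> int) (g : 'I_m -> M),
     (forall k, G (g k)) /\ x = \sum_(k < m) g k *~ c k].

Lemma zspan_gen (M : zmodType) (G : set M) x : G x -> zspan G x.
Proof.
by move=> Gx; exists 1%N, (fun=> 1), (fun=> x); rewrite big_ord1 mulr1z.
Qed.

Lemma zspan0 (M : zmodType) (G : set M) : zspan G 0.
Proof.
exists 0%N, (fun=> 0), (fun=> 0).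
by split; [case | rewrite big_ord0].
Qed.

Lemma zspanB (M : zmodType) (G : set M) x y :
  zspan G x -> zspan G y -> zspan G (x - y).
Proof.
move=> [m [c [g [Gg ->]]]] [m' [c' [g' [Gg' ->]]]].
exists (m + m')%N.
exists (fun k => match fintype.split k with inl i => c i | inr j => - c' j end).
exists (fun k => match fintype.split k with inl i => g i | inr j => g' j end).
split; first by move=> k; case: (fintype.split k).
rewrite big_split_ord /=; congr (_ + _).
  by apply: eq_bigr => i _; rewrite (unsplitK (inl i)).
rewrite -sumrN; apply: eq_bigr => i _.
by rewrite (unsplitK (inr i)) mulrNz.
Qed.

Lemma zspanM (R : pzRingType) (G : set R) :
  (forall x y, G x -> G y -> G (x * y)) ->
  forall x y, zspan G x -> zspan G y -> zspan G (x * y).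
Proof.
move=> GM x y [m [c [g [Gg ->]]]] [m' [c' [g' [Gg' ->]]]].
have zD u v : zspan G u -> zspan G v -> zspan G (u + v).
  move=> Gu Gv; rewrite -[v]opprK; apply: zspanB => //.
  by rewrite -sub0r; apply: zspanB => //; exact: zspan0.
rewrite mulr_suml; apply: (big_ind (zspan G)); [exact: zspan0 | exact: zD | move=> i _].
rewrite mulr_sumr; apply: (big_ind (zspan G)); [exact: zspan0 | exact: zD | move=> j _].
exists 1%N, (fun=> c' j * c i), (fun=> g i * g' j); split.
  by move=> _; apply: GM.
by rewrite big_ord1 mulrzAl mulrzAr -mulrzA.
Qed.

Record subring (R : nzRingType) := Subring {
  subring_set : set R;
  subringP : subring_closed [pred x | `[< subring_set x >]]
}.

Definition subring_pred (R : nzRingType) (S : subring R) : R -> bool :=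
  [pred x | `[< subring_set S x >]].

HB.instance Definition _ (R : nzRingType) (S : subring R) :=
  GRing.isSubringClosed.Build R (subring_pred S) (subringP S).

Record subring_sort (R : nzRingType) (S : subring R) := SubringElt {
  sr_val : R;
  _ : sr_val \in subring_pred S
}.

HB.instance Definition _ (R : nzRingType) (S : subring R) :=
  [isSub for @sr_val R S].
HB.instance Definition _ (R : nzRingType) (S : subring R) :=
  [Choice of subring_sort S by <:].
HB.instance Definition _ (R : nzRingType) (S : subring R) :=
  [SubChoice_isSubNzRing of subring_sort S by <:].

Coercion subring_sort : subring >-> Sortclass.

Definition semilinear_along (R R' : comNzRingType) (f : {rmorphism R -> R'})
    (M : lmodType R) (N : lmodType R') (h : M -> N) : Prop :=
  forall a x, h (a *: x) = f a *: h x.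

(* [g : D -> D'] exhibits the R'-algebra [D'] as the extension of scalars of the
   R-algebra [D] along [f], with [g x] playing the role of x (x) 1: it is a
   semilinear ring homomorphism that is universal among the semilinear maps to
   R'-modules. *)
Definition is_base_change (R R' : comNzRingType) (f : {rmorphism R -> R'})
    (D : algType R) (D' : algType R') (g : {rmorphism D -> D'}) : Prop :=
  semilinear_along f g /\
  forall (N : lmodType R') (h : {additive D -> N}), semilinear_along f h ->
    exists k : {linear D' -> N},
      (forall x, k (g x) = h x) /\
      (forall k' : {linear D' -> N}, (forall x, k' (g x) = h x) -> k' =1 k).

(* k[X, X^-1], as the subring of the fraction field of k[X] consisting of the
   p / X^m.  For k = int the ambient field is Q(X). *)
Definition is_laurent (k : idomainType) (x : {fraction {poly k}}) : Prop :=
  exists (p : {poly k}) (m : nat), x = tofrac p / tofrac 'X ^+ m.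

Definition laurent_pred (k : idomainType) : {fraction {poly k}} -> bool :=
  fun x => `[< is_laurent x >].

Lemma fracX_neq0 (k : idomainType) : tofrac ('X : {poly k}) != 0.
Proof. by rewrite tofrac_eq0 polyX_eq0. Qed.

Lemma laurent_closed (k : idomainType) : subring_closed (@laurent_pred k).
Proof.
split.
- by apply/asboolP; exists 1, 0%N; rewrite expr0 divr1 tofrac1.
- move=> x y /asboolP[p [m ->]] /asboolP[q [l ->]].
  apply/asboolP; exists (p * 'X^l - q * 'X^m), (m + l)%N.
  rewrite rmorphB !rmorphM !rmorphXn /= mulrBl exprD invfM.
  have X0 j : tofrac ('X : {poly k}) ^+ j != 0 by rewrite expf_neq0 // fracX_neq0.
  congr (_ - _).
    by rewrite mulrACA divff // mulr1.
  by rewrite [_^-1 * _]mulrC mulrACA divff // mulr1.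
- move=> x y /asboolP[p [m ->]] /asboolP[q [l ->]].
  apply/asboolP; exists (p * q), (m + l)%N.
  by rewrite rmorphM exprD invfM mulrACA.
Qed.

HB.instance Definition _ (k : idomainType) :=
  GRing.isSubringClosed.Build _ (@laurent_pred k) (@laurent_closed k).

Record laurent (k : idomainType) := Laurent {
  lval : {fraction {poly k}};
  _ : lval \in @laurent_pred k
}.

HB.instance Definition _ (k : idomainType) := [isSub for @lval k].
HB.instance Definition _ (k : idomainType) := [Choice of laurent k by <:].
HB.instance Definition _ (k : idomainType) :=
  [SubChoice_isSubComNzRing of laurent k by <:].

(* k[X] in k[X, X^-1] *)
Lemma lpoly_subproof (k : idomainType) (p : {poly k}) :
  tofrac p \in @laurent_pred k.
Proof. by apply/asboolP; exists p, 0%N; rewrite expr0 divr1. Qed.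

Definition lpoly (k : idomainType) (p : {poly k}) : laurent k :=
  Laurent (lpoly_subproof p).

Lemma lvarz_subproof (k : idomainType) (z : int) :
  tofrac ('X : {poly k}) ^ z \in @laurent_pred k.
Proof.
apply/asboolP; case: z => m.
  by exists 'X^m, 0%N; rewrite expr0 divr1 rmorphXn.
by exists 1, m.+1; rewrite tofrac1 mul1r.
Qed.

(* X^z, z an integer *)
Definition lvarz (k : idomainType) (z : int) : laurent k :=
  Laurent (lvarz_subproof k z).

(* specialization at X = 1 *)
Lemma ev1_exists (k : idomainType) (x : laurent k) :
  exists c : k, exists (p : {poly k}) (m : nat),
    lval x = tofrac p / tofrac 'X ^+ m /\ c = p.[1].
Proof. by case: x => x /= /asboolP[p [m e]]; exists p.[1], p, m. Qed.

Definition ev1 (k : idomainType) (x : laurent k) : k :=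
  projT1 (cid (ev1_exists x)).

Lemma ev1E (k : idomainType) (x : laurent k) (p : {poly k}) (m : nat) :
  lval x = tofrac p / tofrac 'X ^+ m -> ev1 x = p.[1].
Proof.
rewrite /ev1; case: cid => c /= [q [l [-> ->]]] /eqP.
rewrite eqr_div ?expf_neq0 ?fracX_neq0 //.
rewrite -!rmorphXn -!rmorphM tofrac_eq => /eqP /(congr1 (horner^~ 1)).
by rewrite !hornerM !hornerXn !expr1n !mulr1.
Qed.

Lemma ev1_lpoly (k : idomainType) (p : {poly k}) : ev1 (lpoly p) = p.[1].
Proof. by apply: (@ev1E _ _ p 0); rewrite expr0 divr1. Qed.

Lemma ev1_lvarz (k : idomainType) (z : int) : ev1 (lvarz k z) = 1.
Proof.
case: z => m.
  rewrite (@ev1E _ _ 'X^m 0) ?hornerXn ?expr1n //.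
  by rewrite expr0 divr1 rmorphXn.
by rewrite (@ev1E _ _ 1 m.+1) ?hornerC // tofrac1 mul1r.
Qed.

Lemma ev1_is_zmod_morphism (k : idomainType) : zmod_morphism (@ev1 k).
Proof.
move=> x y; case: (ev1_exists x) => c [p [m [ex _]]].
case: (ev1_exists y) => d [q [l [ey _]]].
rewrite (ev1E ex) (ev1E ey).
have X0 j : tofrac ('X : {poly k}) ^+ j != 0 by rewrite expf_neq0 // fracX_neq0.
rewrite (@ev1E _ _ (p * 'X^l - q * 'X^m) (m + l)).
  by rewrite !hornerE !expr1n !mulr1.
rewrite -[lval _]/(\val (x - y)) rmorphB /= ex ey rmorphB !rmorphM !rmorphXn /= mulrBl exprD invfM.
congr (_ - _).
  by rewrite mulrACA divff // mulr1.
by rewrite [_^-1 * _]mulrC mulrACA divff // mulr1.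
Qed.

Lemma ev1_is_monoid_morphism (k : idomainType) : monoid_morphism (@ev1 k).
Proof.
split.
  by rewrite (@ev1E _ _ 1 0) ?hornerC // expr0 divr1 tofrac1.
move=> x y; case: (ev1_exists x) => c [p [m [ex _]]].
case: (ev1_exists y) => d [q [l [ey _]]].
rewrite (ev1E ex) (ev1E ey) (@ev1E _ _ (p * q) (m + l)) ?hornerM //.
by rewrite -[lval _]/(\val (x * y)) rmorphM /= ex ey rmorphM exprD invfM mulrACA.
Qed.

HB.instance Definition _ (k : idomainType) :=
  GRing.isZmodMorphism.Build _ _ (@ev1 k) (@ev1_is_zmod_morphism k).
HB.instance Definition _ (k : idomainType) :=
  GRing.isMonoidMorphism.Build _ _ (@ev1 k) (@ev1_is_monoid_morphism k).

(* Z[v, v^-1] and its fraction field Q(v); Q is a Z[v, v^-1]-module via [spec1Q] *)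
Definition Zv : comNzRingType := laurent int.
Definition Qv : fieldType := {fraction {poly int}}.

Definition spec1Q : {rmorphism Zv -> rat} := (intr : int -> rat) \o @ev1 int.

(* the polynomial [p], given in the variable v^2 *)
Definition poly_v2 (p : {poly int}) : Zv := lpoly (p \Po 'X^2).

Section Periodic.
Variable n : nat.

Definition periodic_band (T : nmodType) (a : int -> int -> T) : Prop :=
  [/\ forall i j, a i j = a (i + n%:Z) (j + n%:Z),
      forall i, finite_set [set j | a i j != 0]
    & forall j, finite_set [set i | a i j != 0]].

Record Theta := MkTheta {
  theta_fun :> int -> int -> nat;
  thetaP : periodic_band theta_fun
}.
HB.instance Definition _ := gen_eqMixin Theta.
HB.instance Definition _ := gen_choiceMixin Theta.

Definition Theta_plus : set Theta := [set A | forall i j : int, j <= i -> A i j = 0%N].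

Record Nseq := MkNseq {
  nseq_fun :> int -> nat;
  nseqP : forall i, nseq_fun i = nseq_fun (i - n%:Z)
}.
HB.instance Definition _ := gen_eqMixin Nseq.
HB.instance Definition _ := gen_choiceMixin Nseq.

Definition sigma (A : Theta) : nat :=
  (\sum_(1 <= i < n.+1) \sum_(j \in [set: int]) A i%:Z j)%R.

Definition Theta_r (r : nat) : set Theta := [set A | sigma A = r].

Definition Lambda (r : nat) : set Nseq :=
  [set l | (\sum_(1 <= i < n.+1) l i%:Z)%N = r].

(* E^triangle_(i,j): the (k, l) entry is 1 iff (k, l) = (i + sn, j + sn) for some integer s *)
Definition Etri_fun (i j : int) : int -> int -> nat :=
  fun k l => ((k - i == l - j) && (n%:Z %| k - i)%Z : nat).

Lemma Etri_subproof i j : periodic_band (Etri_fun i j).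
Proof.
split.
- move=> k l; rewrite /Etri_fun (addrAC k) (addrAC l) (inj_eq (addIr _)).
  by rewrite (rpredDr (k - i) (dvdzz n%:Z)).
- move=> k; apply: (@sub_finite_set _ _ [set (k - i + j)]); last exact: finite_set1.
  move=> l /=; rewrite /Etri_fun; case: (eqVneq (k - i) (l - j)) => //= e _.
  by rewrite e subrK.
- move=> l; apply: (@sub_finite_set _ _ [set (l - j + i)]); last exact: finite_set1.
  move=> k /=; rewrite /Etri_fun; case: (eqVneq (k - i) (l - j)) => //= e _.
  by rewrite -e subrK.
Qed.

Definition Etri (i j : int) : Theta := MkTheta (Etri_subproof i j).

Lemma add_subproof (A B : Theta) : periodic_band (fun i j => (A i j + B i j)%N).
Proof.
case: A => a [pa ra ca]; case: B => b [pb rb cb] /=; split.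
- by move=> i j; rewrite pa pb.
- move=> i; apply: (@sub_finite_set _ _ ([set j | a i j != 0] `|` [set j | b i j != 0])).
    by move=> j /=; rewrite addn_eq0 negb_and => /orP.
  by rewrite finite_setU.
- move=> j; apply: (@sub_finite_set _ _ ([set i | a i j != 0] `|` [set i | b i j != 0])).
    by move=> i /=; rewrite addn_eq0 negb_and => /orP.
  by rewrite finite_setU.
Qed.

Definition Theta_add (A B : Theta) : Theta := MkTheta (add_subproof A B).

Lemma tr_subproof (A : Theta) : periodic_band (fun i j => A j i).
Proof. by case: A => a [pa ra ca] /=; split. Qed.

Definition Theta_tr (A : Theta) : Theta := MkTheta (tr_subproof A).

Lemma diag_subproof (l : Nseq) :
  periodic_band (fun i j : int => if i == j then l i else 0%N).
Proof.
split.
- by move=> i j; rewrite (inj_eq (addIr _)) (nseqP l (i + n%:Z)) addrK.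
- move=> i; apply: (@sub_finite_set _ _ [set i]); last exact: finite_set1.
  by move=> j /=; case: (eqVneq i j) => //= _; rewrite eqxx.
- move=> j; apply: (@sub_finite_set _ _ [set j]); last exact: finite_set1.
  by move=> i /=; case: (eqVneq i j) => //= _; rewrite eqxx.
Qed.

(* diag(l) = sum over 1 <= i <= n of l_i E_(i,i) *)
Definition Theta_diag (l : Nseq) : Theta := MkTheta (diag_subproof l).

Definition dimv (A : Theta) (i : int) : nat :=
  (\sum_(st \in [set st : int * int | (st.1 <= i)%R /\ (i < st.2)%R]) A st.1 st.2)%R.

Definition euler (l m : int -> int) : int :=
  \sum_(1 <= i < n.+1) l i%:Z * m i%:Z - \sum_(1 <= i < n.+1) l i%:Z * m (i%:Z + 1).

Definition eulerd (A B : Theta) : int :=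
  euler (fun i => (dimv A i)%:Z) (fun i => (dimv B i)%:Z).

End Periodic.

Section Quiver.
Variable n : nat.

(* The vertex set Z/nZ is 'I_n, with [ordS i] = i + 1 mod n. *)
Record rep (F : fieldType) := Rep {
  rep_sp : 'I_n -> vectType F;
  rep_map : forall i : 'I_n, 'Hom(rep_sp i, rep_sp (ordS i))
}.

Definition rep_hom (F : fieldType) (V W : rep F)
    (f : forall i, 'Hom(rep_sp V i, rep_sp W i)) : Prop :=
  forall i x, f (ordS i) (rep_map V i x) = rep_map W i (f i x).

Definition subrep (F : fieldType) (V : rep F) (N : forall i, {vspace rep_sp V i}) : Prop :=
  forall i, (rep_map V i @: N i <= N (ordS i))%VS.

(* N is isomorphic to W: there is an injective morphism W -> V with image N *)
Definition sub_iso (F : fieldType) (V : rep F) (N : forall i, {vspace rep_sp V i})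
    (W : rep F) : Prop :=
  exists f : forall i, 'Hom(rep_sp W i, rep_sp V i),
    rep_hom f /\ forall i, lker (f i) = 0%VS /\ limg (f i) = N i.

(* V / N is isomorphic to W: there is a surjective morphism V -> W with kernel N *)
Definition quot_iso (F : fieldType) (V : rep F) (N : forall i, {vspace rep_sp V i})
    (W : rep F) : Prop :=
  exists f : forall i, 'Hom(rep_sp V i, rep_sp W i),
    rep_hom f /\ forall i, lker (f i) = N i /\ limg (f i) = fullv.

(* M^{i,j} is uniserial with basis m_i, ..., m_(j-1), where m_s sits at the vertex
   s mod n, and the arrows send m_s to m_(s+1), with m_j read as 0.  Its length is
   j - i and its top is S_i.  A basis of M(A) is thus given by the (i, j, k, s)
   with 1 <= i <= n, i < j, k < a_(i,j) and i <= s < j: the vector m_s in the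
   k-th copy of M^{i,j}.  [Mbasis A v] are those basis vectors sitting at v. *)
Definition Mindex : choiceType := (int * int * nat * int)%type.

Definition Mbasis (A : Theta n) (v : 'I_n) : set Mindex :=
  [set x | let: (i, j, k, s) := x in
    [/\ (1 <= i) && (i <= n%:Z), i < j, (k < A i j)%N, (i <= s) && (s < j)
      & (s = (v : nat)%:Z %[mod n%:Z])%Z]].

Definition Msp (F : fieldType) (A : Theta n) (v : 'I_n) : vectType F :=
  {ffun fset_set (Mbasis A v) -> F^o}.

(* in coordinates, the coefficient of m_s in the image of f is that of m_(s-1) in f *)
Definition Mmap (F : fieldType) (A : Theta n) (v : 'I_n)
    (f : {ffun fset_set (Mbasis A v) -> F^o}) :
    {ffun fset_set (Mbasis A (ordS v)) -> F^o} :=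
  [ffun x => let: (i, j, k, s) := val x in
     if insub ((i, j, k, s - 1) : Mindex) is Some y then f y else 0].

Definition Mrep (F : fieldType) (A : Theta n) : rep F :=
  @Rep F (Msp F A) (fun v => linfun (@Mmap F A v : Msp F A v -> Msp F A (ordS v))).

Definition hall_set (F : fieldType) (A B C : Theta n) :
    set (forall i, {vspace rep_sp (Mrep F C) i}) :=
  [set N | [/\ subrep N, sub_iso N (Mrep F B) & quot_iso N (Mrep F A)]].

(* [phi A B C] is the Hall polynomial phi^C_{A,B}, as a polynomial in v^2 *)
Definition is_hall_poly (phi : Theta n -> Theta n -> Theta n -> {poly int}) : Prop :=
  forall A B C, Theta_plus A -> Theta_plus B -> Theta_plus C ->
  forall F : finFieldType, exists k : nat,
    has_card (@hall_set F A B C) k /\ (phi A B C).[#|F|%:Z] = k%:Z.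

Definition is_hall_alg_plus (phi : Theta n -> Theta n -> Theta n -> {poly int})
    (D : algType Zv) (u : Theta n -> D) : Prop :=
  is_basis (@Theta_plus n) u /\
  forall A B, Theta_plus A -> Theta_plus B ->
    u A * u B = \sum_(C \in @Theta_plus n)
      (lvarz int (eulerd A B) * poly_v2 (phi A B C) : Zv) *: u C.

Definition is_hall_alg_minus (phi : Theta n -> Theta n -> Theta n -> {poly int})
    (D : algType Zv) (u : Theta n -> D) : Prop :=
  is_basis (@Theta_plus n) u /\
  forall A B, Theta_plus A -> Theta_plus B ->
    u A * u B = \sum_(C \in @Theta_plus n)
      (lvarz int (eulerd B A) * poly_v2 (phi B A C) : Zv) *: u C.

End Quiver.

Section Loop.
Variable n : nat.

Definition loop_pred : (int -> int -> rat^o) -> bool := fun a => `[< periodic_band n a >].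

Lemma loop_closed : submod_closed loop_pred.
Proof.
split.
  apply/asboolP; split=> //.
    by move=> i; rewrite (_ : [set _ | _] = set0) //; apply/seteqP; split=> j //=; rewrite eqxx.
  by move=> j; rewrite (_ : [set _ | _] = set0) //; apply/seteqP; split=> i //=; rewrite eqxx.
move=> c x y /asboolP[px rx cx] /asboolP[py ry cy]; apply/asboolP.
have E i j : (c *: x + y) i j = c * x i j + y i j by [].
have nz (a b : rat) : c * a + b != 0 -> a != 0 \/ b != 0.
  by case: (eqVneq a 0) => [->|]; [rewrite mulr0 add0r; right | left].
split.
- by move=> i j; rewrite !E px py.
- move=> i; apply: (@sub_finite_set _ _ ([set j | x i j != 0] `|` [set j | y i j != 0])).
    by move=> j /=; rewrite E => /nz.
  by rewrite finite_setU.
- move=> j; apply: (@sub_finite_set _ _ ([set i | x i j != 0] `|` [set i | y i j != 0])).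
    by move=> i /=; rewrite E => /nz.
  by rewrite finite_setU.
Qed.

HB.instance Definition _ :=
  GRing.isSubmodClosed.Build rat (int -> int -> rat^o) loop_pred loop_closed.

(* gl_n(Q) (x) Q[t, t^-1], as periodic matrices *)
Record loop := MkLoop {
  loop_val :> int -> int -> rat^o;
  _ : loop_val \in loop_pred
}.
HB.instance Definition _ := [isSub for loop_val].
HB.instance Definition _ := [Choice of loop by <:].
HB.instance Definition _ := [SubChoice_isSubLmodule of loop by <:].

Definition mxprod (a b : int -> int -> rat^o) : int -> int -> rat^o :=
  fun i j => \sum_(k \in [set: int]) (a i k : rat) * b k j.

Lemma mxprod_subproof (a b : loop) : mxprod a b \in loop_pred.
Proof.
case: a => a /= /asboolP[pa ra ca]; case: b => b /= /asboolP[pb rb cb].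
have nz i j : mxprod a b i j != 0 -> exists k, a i k != 0 /\ b k j != 0.
  rewrite /mxprod => h; have [k _] := fsbigN1 (f := fun i k => (a i k : rat) * b k j) h.
  by rewrite mulf_eq0 negb_or => /andP[? ?]; exists k.
apply/asboolP; split.
- move=> i j; rewrite /mxprod [RHS](reindex_fsbigT (fun k : int => k + n%:Z)).
    by apply: eq_fsbigr => k _; rewrite pa pb.
  by exists (fun k : int => k - n%:Z) => k; rewrite ?addrK ?subrK.
- move=> i.
  apply: (@sub_finite_set _ _ (\bigcup_(k in [set k | a i k != 0]) [set j | b k j != 0])).
    by move=> j /= /nz[k [? ?]]; exists k.
  by apply: bigcup_finite.
- move=> j.
  apply: (@sub_finite_set _ _ (\bigcup_(k in [set k | b k j != 0]) [set i | a i k != 0])).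
    by move=> i /= /nz[k [? ?]]; exists k.
  by apply: bigcup_finite.
Qed.

Definition loop_mul (a b : loop) : loop := MkLoop (mxprod_subproof a b).
Definition loop_br (a b : loop) : loop := loop_mul a b - loop_mul b a.

Lemma loop_of_subproof (A : Theta n) :
  (fun i j => (A i j)%:R : rat^o) \in loop_pred.
Proof.
case: A => a [pa ra ca] /=; apply/asboolP; split.
- by move=> i j; rewrite pa.
- move=> i; apply: sub_finite_set (ra i) => j /=.
  by apply: contra => /eqP ->.
- move=> j; apply: sub_finite_set (ca j) => i /=.
  by apply: contra => /eqP ->.
Qed.

Definition loop_of (A : Theta n) : loop := MkLoop (loop_of_subproof A).

End Loop.

Definition is_lie_hom (L : lmodType rat) (br : L -> L -> L) (A : algType rat)
    (f : L -> A) : Prop :=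
  forall x y, f (br x y) = f x * f y - f y * f x.

Definition is_enveloping (L : lmodType rat) (br : L -> L -> L) (U : algType rat)
    (iota : {linear L -> U}) : Prop :=
  is_lie_hom br iota /\
  forall (A : algType rat) (f : {linear L -> A}), is_lie_hom br f ->
    exists h : {lrmorphism U -> A},
      (forall x, h (iota x) = f x) /\
      (forall h' : {lrmorphism U -> A}, (forall x, h' (iota x) = f x) -> h' =1 h).

Definition binomU (U : algType rat) (x : U) (m : nat) : U :=
  (m`!%:R^-1 : rat) *: \prod_(0 <= k < m) (x - k%:R).

(* U_Z, for families wp = (w_A^+), wm = (w_A^-) *)
Definition U_Z (n : nat) (U : algType rat) (iota : loop n -> U)
    (wp wm : Theta n -> U) : set U :=
  zspan [set x | exists (A B : Theta n) (l : Nseq n),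
    [/\ Theta_plus A, Theta_plus B
      & x = wp A * (\prod_(1 <= i < n.+1) binomU (iota (loop_of (Etri n i%:Z i%:Z))) (l i%:Z))
              * wm B]].

Section Schur.
Variables n r : nat.

Section Flags.
Variable F : fieldType.

(* the free F[e, e^-1]-module of rank r *)
Definition Vr : lmodType (laurent F) := 'rV[laurent F]_r.

Definition is_lattice (L : set Vr) : Prop :=
  exists b : 'I_r -> Vr,
    [/\ L = range (fun q : 'I_r -> {poly F} => \sum_(i < r) lpoly (q i) *: b i),
        injective (fun q : 'I_r -> {poly F} => \sum_(i < r) lpoly (q i) *: b i)
      & forall x : Vr, exists c : 'I_r -> laurent F, x = \sum_(i < r) c i *: b i].

Definition is_flag (L : int -> set Vr) : Prop :=
  [/\ forall i, is_lattice (L i),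
      forall i, L (i - 1) `<=` L i
    & forall i, L (i - n%:Z) = [set lpoly 'X *: x | x in L i]].

(* the F-vector space X / Y has a basis with d elements *)
Definition quot_dim (X Y : set Vr) (d : nat) : Prop :=
  exists x : 'I_d -> Vr, (forall k, X (x k)) /\
    forall z, X z -> exists! c : 'I_d -> F,
      Y (z - \sum_(k < d) lpoly (c k)%:P *: x k).

(* A(L, L') = A *)
Definition rel_pos (L L' : int -> set Vr) (A : Theta n) : Prop :=
  forall i j : int,
    quot_dim (L i `&` L' j)
      [set y + z | y in L (i - 1) `&` L' j & z in L i `&` L' (j - 1)] (A i j).

End Flags.

(* [p A B C] is p_{A,B,C}, as a polynomial in v^2 *)
Definition is_schur_poly (p : Theta n -> Theta n -> Theta n -> {poly int}) : Prop :=
  forall A B C, Theta_r r A -> Theta_r r B -> Theta_r r C ->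
  forall (F : finFieldType) (L L'' : int -> set (Vr F)),
    is_flag L -> is_flag L'' -> rel_pos L L'' C ->
    exists k : nat,
      has_card [set L' | [/\ is_flag L', rel_pos L L' A & rel_pos L' L'' B]] k /\
      (p A B C).[#|F|%:Z] = k%:Z.

Definition is_schur_alg (p : Theta n -> Theta n -> Theta n -> {poly int})
    (bS : algType Qv) (e : Theta n -> bS) : Prop :=
  is_basis (Theta_r r) e /\
  forall A B, Theta_r r A -> Theta_r r B ->
    e A * e B = \sum_(C \in Theta_r r) (lval (poly_v2 (p A B C)) : Qv) *: e C.

(* the inner index x is (j, k, l) *)
Definition dA (A : Theta n) : nat :=
  (\sum_(1 <= i < n.+1)
     \sum_(x \in [set x : int * int * int | (x.1.2 <= i%:Z)%R /\ (x.1.1 < x.2)%R])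
       (A i%:Z x.1.1 * A x.1.2 x.2)%N)%R.

(* [A] in the algebra over Q(v) *)
Definition brQv (bS : algType Qv) (e : Theta n -> bS) (A : Theta n) : bS :=
  (lval (lvarz int (- (dA A)%:Z)) : Qv) *: e A.

(* S (with [br A] standing for [A]) is identified by [incl] with the Z[v, v^-1]-span of the
   [A] in bS *)
Definition is_integral_form (bS : algType Qv) (e : Theta n -> bS)
    (S : algType Zv) (br : Theta n -> S) (incl : {rmorphism S -> bS}) : Prop :=
  [/\ injective incl,
      forall (a : Zv) x, incl (a *: x) = (lval a : Qv) *: incl x,
      forall A, Theta_r r A -> incl (br A) = brQv e A
    & spans (Theta_r r) br].

Definition A0r (S : algType Zv) (br : Theta n -> S) (A : Theta n) : S :=
  if (sigma A <= r)%N
  then \sum_(l \in @Lambda n (r - sigma A)) br (Theta_add A (Theta_diag l))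
  else 0.

(* S_{r,Z} inside S_{r,Q} = S (x) Q, where tens x = x (x) 1: the image of S (x) Z *)
Definition S_Z (S : algType Zv) (SQ : algType rat) (tens : {rmorphism S -> SQ}) : set SQ :=
  zspan (range tens).

Lemma S_Z_subring (S : algType Zv) (SQ : algType rat) (tens : {rmorphism S -> SQ}) :
  subring_closed [pred x | `[< S_Z tens x >]].
Proof.
split.
- by apply/asboolP/zspan_gen; exists 1 => //; rewrite rmorph1.
- by move=> x y /asboolP hx /asboolP hy; apply/asboolP; exact: zspanB.
- move=> x y /asboolP hx /asboolP hy; apply/asboolP; apply: zspanM hx hy.
  by move=> _ _ [a _ <-] [b _ <-]; exists (a * b) => //; rewrite rmorphM.
Qed.

End Schur.

Section Maps.
Variable n : nat.
Variables (U : algType rat) (iota : loop n -> U).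

Definition is_theta_plus (D : algType Zv) (u : Theta n -> D) (DQ : algType rat)
    (tens : D -> DQ) (theta : {lrmorphism DQ -> U}) : Prop :=
  injective theta /\
  forall i j : int, i < j -> theta (tens (u (Etri n i j))) = iota (loop_of (Etri n i j)).

Definition is_theta_minus (D : algType Zv) (u : Theta n -> D) (DQ : algType rat)
    (tens : D -> DQ) (theta : {lrmorphism DQ -> U}) : Prop :=
  injective theta /\
  forall i j : int, i < j -> theta (tens (u (Etri n i j))) = iota (loop_of (Etri n j i)).

(* The last three clauses are known consequences of the first two. *)
Definition is_eta (r : nat) (wp wm : Theta n -> U) (S : algType Zv)
    (br : Theta n -> S) (SQ : algType rat) (tens : S -> SQ)
    (eta : {lrmorphism U -> SQ}) : Prop :=
  [/\ forall i j : int, i != j ->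
        eta (iota (loop_of (Etri n i j))) = tens (A0r r br (Etri n i j)),
      forall i : int,
        eta (iota (loop_of (Etri n i i))) =
          \sum_(l \in @Lambda n r) (l i)%:R *: tens (br (Theta_diag l)),
      forall y : SQ, exists x : U, eta x = y,
      forall A, Theta_plus A -> eta (wp A) = tens (A0r r br A)
    & forall A, Theta_plus A -> eta (wm A) = tens (A0r r br (Theta_tr A))].

End Maps.

(* Main.v *)
Require Import Defs.
From HB Require Import structures.
From mathcomp Require Import all_boot all_order all_algebra.
From mathcomp Require Import finmap all_classical.
From mathcomp Require Import zify ring.

Set Implicit Arguments.
Unset Strict Implicit.
Unset Printing Implicit Defensive.

Import Order.TTheory GRing.Theory Num.Theory.

Local Open Scope classical_set_scope.
Local Open Scope ring_scope.

(** At v = 1 the algebra S_Q is spanned over Q, and S_Z over the integers, by the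
    elements [A]_1 with A in Theta(n, r), and their products are given by the
    numbers p_{A,B,C}(1).  These numbers are computed by counting flags over
    finite fields: a polynomial taking the same value at the order of every
    finite field is constant ([poly_const_finFields]).

    A matrix A of size r is the same thing as a family of r pairs (f k, g k) of
    integers up to translation by n ([lmat_exists]); it is the relative position
    of the two standard flags in which the k-th basis vector appears in degrees
    f k and g k ([sflag_rel_pos]).  The flags standard for the same basis are
    closed under intersection, which takes the maximum h of the labels.

    The image lies in S_Z.  If L' has diagonal position relative to L, then
    L' = L; hence the [diag l]_1 are orthogonal idempotents with sum 1, each of
    which acts on [A]_1 as 0 or 1 ([br1_diag_l], [br1_diag_r], [weight_sum1]).
    The product of the binomials in the E_ii therefore acts on [diag m]_1 by the
    natural number prod_i binom(m_i, l_i) ([eta_binom]), and the images of the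
    w_A are sums of basis elements ([eta_U_Z]).

    The image is all of S_Z.  For l of size r the product of binomials maps to
    [diag l]_1 itself ([weight_sum_delta]).  With l = dg h, the generator
    w_A^+ prod_i binom(E_ii, l_i) w_B^- built from the strictly triangular parts
    of A = lmat f g maps to [X]_1 [Y]_1, where X = lmat f h is upper triangular
    and Y = lmat h g is lower triangular ([integral_image_tri]).  If L' has
    position X from L and Y to L'', then L' lies in the intersection of L and
    L''.  When (L, L'') has position A, the codimension of L' in L is that of the
    intersection, so L' equals it and p_{X,Y,A} = 1 ([schur_tri_diag]).  When
    (L, L'') has position C different from A, the inclusion is strict in some
    degree, so the dimensions of L_J / (L_J meet L''_J) for C are at most those
    for A and one of them is smaller ([schur_tri_lower]).  So [X]_1 [Y]_1 is [A]_1 plus an integral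
    combination of [C]_1 with smaller total dimension, and induction on that
    dimension puts every [A]_1 in the image ([integral_image_basis]). *)

(** * Dimensions of subquotients *)

Section SubquotientDimension.
Variables (F : fieldType) (W : lmodType F).
Implicit Types (X Y Z P Q : set W).

Definition subspace X := X 0 /\ forall c x y, X x -> X y -> X (c *: x + y).

(** The relation [quot_dim] over an arbitrary vector space. *)
Definition qdim X Y d := exists x : 'I_d -> W, (forall k, X (x k)) /\
  forall z, X z -> exists! c : 'I_d -> F, Y (z - \sum_(k < d) c k *: x k).

Definition sumset P Q : set W := [set y + z | y in P & z in Q].

Lemma subspaceD X x y : subspace X -> X x -> X y -> X (x + y).
Proof. by move=> [_ h] hx hy; rewrite -[x]scale1r; apply: h. Qed.

Lemma subspaceZ X c x : subspace X -> X x -> X (c *: x).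
Proof. by move=> [h0 h] hx; rewrite -[_ *: _]addr0; apply: h. Qed.

Lemma subspaceN X x : subspace X -> X x -> X (- x).
Proof. by move=> hX hx; rewrite -scaleN1r; apply: subspaceZ. Qed.

Lemma subspaceB X x y : subspace X -> X x -> X y -> X (x - y).
Proof. by move=> hX hx hy; apply: subspaceD => //; apply: subspaceN. Qed.

Lemma subspace_sum X d (c : 'I_d -> F) (x : 'I_d -> W) :
  subspace X -> (forall k, X (x k)) -> X (\sum_k c k *: x k).
Proof.
move=> hX hx; apply: (big_ind X); first by case: hX.
  by move=> y z; apply: subspaceD.
by move=> k _; apply: subspaceZ.
Qed.

Lemma subspaceI X Y : subspace X -> subspace Y -> subspace (X `&` Y).
Proof.
move=> [x0 hX] [y0 hY]; split=> // c x y [? ?] [? ?].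
by split; [apply: hX | apply: hY].
Qed.

Lemma subspace_sumset X Y : subspace X -> subspace Y -> subspace (sumset X Y).
Proof.
move=> [x0 hX] [y0 hY]; split; first by exists 0 => //; exists 0 => //; rewrite addr0.
move=> c _ _ [x xX [y yY <-]] [x' xX' [y' yY' <-]].
exists (c *: x + x'); first exact: hX.
by exists (c *: y + y'); [exact: hY | rewrite scalerDr addrACA].
Qed.

Lemma qdim0_sub X Y : qdim X Y 0 -> X `<=` Y.
Proof.
by move=> [x [_ h]] z /h [c []]; rewrite big_ord0 subr0.
Qed.

Lemma qdim_sub0 X Y : X `<=` Y -> qdim X Y 0.
Proof.
move=> XY; exists (fun=> 0); split; first by case.
move=> z /XY zY; exists (fun=> 0); split; first by rewrite big_ord0 subr0.
by move=> c _; apply: funext; case.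
Qed.

(** A basis of X modulo Y followed by a basis of Y modulo Z is one of X modulo Z. *)
Lemma qdim_trans X Y Z a b : subspace X -> subspace Y -> Z `<=` Y -> Y `<=` X ->
  qdim X Y a -> qdim Y Z b -> qdim X Z (a + b).
Proof.
move=> sX sY ZY YX [x [xX hx]] [y [yY hy]].
pose w (k : 'I_(a + b)) := match fintype.split k with inl i => x i | inr j => y j end.
have wl i : w (lshift b i) = x i by rewrite /w (unsplitK (inl i)).
have wr i : w (rshift a i) = y i by rewrite /w (unsplitK (inr i)).
have wS (c : 'I_(a + b) -> F) : \sum_k c k *: w k =
    \sum_i c (lshift b i) *: x i + \sum_j c (rshift a j) *: y j.
  by rewrite big_split_ord; congr (_ + _); apply: eq_bigr => i _; rewrite (wl, wr).
exists w; split.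
  by move=> k; rewrite /w; case: (fintype.split k) => // j; apply: YX.
move=> z zX; have [c [hc uc]] := hx z zX; have [d [hd ud]] := hy _ hc.
exists (fun k => match fintype.split k with inl i => c i | inr j => d j end).
have el i : fintype.split (lshift b i) = inl i := unsplitK (inl i).
have er j : fintype.split (rshift a j) = inr j :> 'I_a + 'I_b := unsplitK (inr j).
split.
  rewrite wS opprD addrA.
  under eq_bigr do rewrite el.
  by under [X in Z (_ - X)]eq_bigr do rewrite er.
move=> g; rewrite wS opprD addrA => hg.
have hg1 : Y (z - \sum_i g (lshift b i) *: x i).
  rewrite -[X in Y X](subrK (\sum_j g (rshift a j) *: y j)).
  by apply: subspaceD => //; [apply: ZY | apply: subspace_sum].
have ec := uc _ hg1.
have ed : d = fun j => g (rshift a j) by apply: ud; rewrite ec.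
apply: funext => k; rewrite -[k]splitK; case: (fintype.split k) => j /=.
  by rewrite el ec.
by rewrite er ed.
Qed.

(** The second isomorphism theorem. *)
Lemma qdim_sumset P Q d : subspace P -> subspace Q ->
  qdim P (P `&` Q) d -> qdim (sumset P Q) Q d.
Proof.
move=> sP sQ [x [xP hx]]; exists x; split.
  by move=> k; exists (x k) => //; exists 0; [case: sQ | rewrite addr0].
move=> _ [y yP [z zQ <-]]; have [c [[_ hc] uc]] := hx y yP.
exists c; split; first by rewrite addrAC; apply: subspaceD.
move=> g hg; apply: uc; split.
  by apply: subspaceB => //; apply: subspace_sum.
have -> : y - \sum_k g k *: x k = y + z - \sum_k g k *: x k - z.
  by rewrite [y + z - _]addrAC addrK.
exact: subspaceB.
Qed.

(** A family independent modulo Y' is independent modulo the smaller Y, so its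
    matrix of coordinates on a basis of X / Y has independent rows. *)
Lemma qdim_mono X Y Y' d d' : subspace X -> subspace Y -> subspace Y' ->
  Y `<=` Y' -> qdim X Y d -> qdim X Y' d' ->
  (d' <= d)%N /\ (d' = d -> X `&` Y' `<=` Y).
Proof.
move=> sX sY sY' YY' [x [xX hx]] [y [yX hy]].
have /choice[C hC] : forall j, exists c : 'I_d -> F, Y (y j - \sum_k c k *: x k).
  by move=> j; have [c [? _]] := hx _ (yX j); exists c.
pose M := \matrix_(j < d', k < d) C j k.
have rel (v : 'rV[F]_d') :
    Y (\sum_j v 0 j *: y j - \sum_k (v *m M) 0 k *: x k).
  have -> : \sum_k (v *m M) 0 k *: x k = \sum_j v 0 j *: \sum_k C j k *: x k.
    under eq_bigr do rewrite mxE scaler_suml.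
    rewrite exchange_big; apply: eq_bigr => j _; rewrite scaler_sumr.
    by apply: eq_bigr => k _; rewrite mxE scalerA.
  rewrite -sumrB; under eq_bigr do rewrite -scalerBr.
  exact: subspace_sum.
(* uniqueness of the coordinates of the vector 0 modulo Y' *)
have indep (v : 'rV[F]_d') : Y' (\sum_j v 0 j *: y j) -> v = 0.
  move=> hv; have [c [hc uc]] := hy 0 (proj1 sX).
  have e0 : c = fun=> 0.
    apply: uc; rewrite big1 ?subr0; last by move=> *; rewrite scale0r.
    by case: sY'.
  have ev : c = (fun j => - v 0 j).
    apply: uc; rewrite sub0r -sumrN; under eq_bigr do rewrite scaleNr opprK.
    exact: hv.
  by apply/rowP => j; move: (congr1 (fun h => h j) ev); rewrite e0 mxE => /eqP;
    rewrite eq_sym oppr_eq0 => /eqP.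
have frM : row_free M.
  rewrite -kermx_eq0; apply/eqP/row_matrixP => i; rewrite row0; apply: indep.
  apply: YY'; have := rel (row i (kermx M)).
  rewrite -row_mul mulmx_ker row0 [X in _ - X]big1 ?subr0 //.
  by move=> k _; rewrite mxE scale0r.
split; first by rewrite -(eqP frM) rank_leq_col.
move=> edd z [zX zY']; have [c [hc _]] := hx z zX.
have fM : row_full M by rewrite /row_full (eqP frM) edd.
have /submxP[v hv] : (\row_k c k <= M)%MS by apply: submx_full.
have hsum : \sum_k c k *: x k = \sum_k (v *m M) 0 k *: x k.
  by apply: eq_bigr => k _; rewrite -hv mxE.
have v0 : v = 0.
  apply: indep; rewrite -[X in Y' X](subrK (\sum_k c k *: x k)).
  apply: subspaceD => //; first by rewrite hsum; apply: YY'.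
  rewrite -[X in Y' X](subKr z).
  by apply: subspaceB => //; apply: YY'.
move: hc; rewrite hsum v0 mul0mx big1 ?subr0 //.
by move=> k _; rewrite mxE scale0r.
Qed.

Lemma qdim_inj X Y d d' : subspace X -> subspace Y ->
  qdim X Y d -> qdim X Y d' -> d = d'.
Proof.
move=> sX sY h h'; apply/eqP; rewrite eqn_leq.
by rewrite (proj1 (qdim_mono sX sY sY _ h h')) // (proj1 (qdim_mono sX sY sY _ h' h)).
Qed.

End SubquotientDimension.

(** * Periodic matrices as label matrices *)

Lemma Theta_eq n (A B : Theta n) : (forall i j, A i j = B i j) -> A = B.
Proof.
case: A => a ha; case: B => b hb /= e.
have eab : a = b by apply: funext => i; apply: funext => j.
by move: ha hb; rewrite eab => ha hb; congr MkTheta; apply: Prop_irrelevance.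
Qed.

Lemma Nseq_eq n (l m : Nseq n) : (forall i, l i = m i) -> l = m.
Proof.
case: l => a ha; case: m => b hb /= e.
have eab : a = b by apply: funext.
by move: ha hb; rewrite eab => ha hb; congr MkNseq; apply: Prop_irrelevance.
Qed.

(** Turns a finitely supported sum into a sum over a list, so that the theory of
    ordinary big operators applies. *)
Lemma fsbig_superset (T : choiceType) (R : nmodType) (P : set T) (D : seq T) (f : T -> R) :
  uniq D -> (forall j, j \in D -> P j) -> (forall j, P j -> f j != 0 -> j \in D) ->
  \sum_(j \in P) f j = \sum_(j <- D) f j.
Proof.
move=> uD DP h; rewrite (fsbigE D) //; last first.
  by move=> j Pj Dj; apply/eqP; apply: contraNT Dj; apply: h.
rewrite [LHS]big_seq_cond [RHS]big_seq; apply: eq_bigl => j.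
by case: (boolP (j \in D)) => //= /DP /mem_set.
Qed.

Lemma dvdz_addMr (d x t : int) : (d %| x + d * t)%Z = (d %| x)%Z.
Proof. by rewrite (rpredDr x (dvdz_mulr t (dvdzz d))). Qed.

(** The integers 1, ..., n represent the residues modulo n, as in the sums over
    one period of a matrix. *)
Lemma residue_inj n (a b : nat) : (1 <= a <= n)%N -> (1 <= b <= n)%N ->
  (n%:Z %| b%:Z - a%:Z)%Z = (b == a).
Proof.
move=> ha hb; apply/idP/eqP => [/dvdzP[q hq]|->]; last by rewrite subrr dvdz0.
have [h|[h|h]] : q = 0 \/ 1 <= q \/ q <= -1 by lia.
all: by nia.
Qed.

Lemma Etri_shift n i j k l (t : int) :
  Etri n i j (k + n%:Z * t) (l + n%:Z * t) = Etri n i j k l.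
Proof.
rewrite /= /Etri_fun addrAC (addrAC l) (inj_eq (addIr _)).
by rewrite dvdz_addMr.
Qed.

Lemma Theta_shift n (A : Theta n) (i j t : int) : A (i + n%:Z * t) (j + n%:Z * t) = A i j.
Proof.
case: (thetaP A) => pA _ _.
have up (m : nat) k l : A (k + n%:Z * m%:Z) (l + n%:Z * m%:Z) = A k l.
  elim: m => [|m IH]; first by rewrite mulr0 !addr0.
  by rewrite -IH [RHS]pA -!addrA -addn1 PoszD mulrDr mulr1.
case: t => m; first exact: up.
by rewrite -(up m.+1 (i + _)) NegzE mulrN !subrK.
Qed.

Lemma Nseq_shift n (l : Nseq n) (i t : int) : l (i + n%:Z * t) = l i.
Proof.
have up (m : nat) k : l (k + n%:Z * m%:Z) = l k.
  elim: m => [|m IH]; first by rewrite mulr0 addr0.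
  by rewrite -IH [LHS]Defs.nseqP -addn1 PoszD mulrDr mulr1 addrA addrK.
case: t => m; first exact: up.
by rewrite -(up m.+1 (i + _)) NegzE mulrN subrK.
Qed.

Lemma residue_exists n (i : int) : (0 < n)%N ->
  exists (a : nat) (t : int), [/\ (1 <= a)%N, (a <= n)%N & i = a%:Z + n%:Z * t].
Proof.
move=> n0; exists (`|(i - 1) %% n%:Z|%Z.+1)%N, ((i - 1) %/ n%:Z)%Z.
have := divz_eq (i - 1) n%:Z; have := modz_ge0 (i - 1) (_ : n%:Z != 0).
have := ltz_pmod (i - 1) (_ : 0 < n%:Z).
by move=> /(_ n0) + /(_ _) => h1 /(_ ltac:(lia)) h2 h3; split; lia.
Qed.

Section LabelMatrix.
Variables n r : nat.
Implicit Types (f g h : 'I_r -> int).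

Lemma lmat_subproof f g :
  periodic_band n (fun i j => (\sum_(k < r) Etri n (f k) (g k) i j)%N).
Proof.
have supp i j : ((\sum_(k < r) Etri n (f k) (g k) i j)%N != 0) ->
    exists k, i - f k = j - g k.
  rewrite sum_nat_eq0 => /forallPn[k]; rewrite /= /Etri_fun.
  by rewrite eqb0 negbK => /andP[/eqP e _]; exists k.
split.
- move=> i j; apply: eq_bigr => k _; rewrite -[in RHS](mulr1 n%:Z).
  by rewrite Etri_shift.
- move=> i; apply: (@sub_finite_set _ _ [set i - f k + g k | k in [set: 'I_r]]).
    by move=> j /= /supp[k e]; exists k => //; rewrite e subrK.
  exact: finite_image.
- move=> j; apply: (@sub_finite_set _ _ [set j - g k + f k | k in [set: 'I_r]]).
    by move=> i /= /supp[k e]; exists k => //; rewrite -e subrK.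
  exact: finite_image.
Qed.

(** The matrix counting the pairs of labels (f k, g k) modulo simultaneous
    translation by n: the relative position of two flags with a common basis
    whose k-th vector enters them in the degrees f k and g k. *)
Definition lmat f g : Theta n := MkTheta (lmat_subproof f g).

Lemma dg_subproof f (i : int) :
  (\sum_(k < r) (n%:Z %| (i - f k)%R)%Z)%N =
  (\sum_(k < r) (n%:Z %| (i - n%:Z - f k)%R)%Z)%N.
Proof.
apply: eq_bigr => k _; rewrite addrAC.
by have := dvdz_addMr n%:Z (i - f k) (-1); rewrite mulrN1 => ->.
Qed.

(** The weight of the labels f: the common row sums of the matrices lmat f g. *)
Definition dg f : Nseq n := MkNseq (dg_subproof f).

Lemma lmatE f g i j :
  lmat f g i j = (\sum_(k < r) ((i - f k == j - g k)%R && (n%:Z %| (i - f k)%R)%Z))%N.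
Proof. by []. Qed.

Lemma lmat_supp f g i j : lmat f g i j != 0%N -> exists k, i - f k = j - g k.
Proof.
rewrite lmatE sum_nat_eq0 => /forallPn[k].
by rewrite /= eqb0 negbK => /andP[/eqP e _]; exists k.
Qed.

Lemma lmat_label f g k : lmat f g (f k) (g k) != 0%N.
Proof.
rewrite lmatE (bigD1 k) //= !subrr eqxx dvdz0.
by rewrite addn_eq0.
Qed.

Lemma lmat_tr f g : Theta_tr (lmat f g) = lmat g f.
Proof.
apply: Theta_eq => i j; rewrite [LHS]lmatE lmatE; apply: eq_bigr => k _.
by rewrite eq_sym; case: eqP => //= ->.
Qed.

Lemma lmat_diag f : lmat f f = Theta_diag (dg f).
Proof.
apply: Theta_eq => i j; rewrite lmatE /=.
rewrite (eq_bigr (fun k => ((i == j) && (n%:Z %| i - f k)%Z : nat))); last first.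
  by move=> k _; rewrite (inj_eq (addIr _)).
by case: eqP => //= _; rewrite big1.
Qed.

Lemma lmat_row f g i : \sum_(j \in [set: int]) lmat f g i j = dg f i.
Proof.
pose D := undup [seq i - f k + g k | k <- enum 'I_r].
rewrite (fsbig_superset (D := D)) ?undup_uniq //; last first.
  move=> j _ /lmat_supp[k e]; rewrite mem_undup; apply/mapP; exists k.
    by rewrite mem_enum.
  by rewrite e subrK.
rewrite /= exchange_big; apply: eq_bigr => k _.
rewrite (bigD1_seq (i - f k + g k)) ?undup_uniq //=; last first.
  by rewrite mem_undup; apply/mapP; exists k; rewrite ?mem_enum.
rewrite /Etri_fun addrK eqxx /= big1 ?addr0 // => j hj.
by rewrite (_ : (_ == _) = false) //; apply/negbTE; lia.
Qed.

(** The diagonal entries are determined by the others and the row sums. *)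
Lemma lmat_offdiag_inj f g f' g' :
  (forall i j, i != j -> lmat f g i j = lmat f' g' i j) -> dg f = dg f' ->
  lmat f g = lmat f' g'.
Proof.
move=> h e; apply: Theta_eq => i j; case: (eqVneq i j) => [<-|]; last exact: h.
(* a common support for both rows, on which the diagonal term can be split off *)
pose D := undup (i :: [seq i - f k + g k | k <- enum 'I_r] ++
                      [seq i - f' k + g' k | k <- enum 'I_r]).
have row u v : {subset [seq i - u k + v k | k <- enum 'I_r] <= D} ->
    dg u i = (lmat u v i i + \sum_(j <- D | j != i) lmat u v i j)%N.
  move=> hD; rewrite -(lmat_row u v) (fsbig_superset (D := D)) ?undup_uniq //.
    by rewrite (bigD1_seq i) ?undup_uniq ?mem_undup ?mem_head.
  move=> z _ /lmat_supp[k ek]; apply: hD; apply/mapP; exists k.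
    by rewrite mem_enum.
  by rewrite ek subrK.
have := congr1 (fun l : Nseq n => l i) e.
rewrite (row f g) => [|x hx]; last by rewrite mem_undup inE mem_cat hx orbT.
rewrite (row f' g') => [|x hx]; last by rewrite mem_undup inE mem_cat hx !orbT.
rewrite [X in (_ + X)%N = _](_ : _ = \sum_(j <- D | j != i) lmat f' g' i j)%N.
  by move/addIn.
by apply: eq_bigr => z zi; apply: h; rewrite eq_sym.
Qed.

Lemma sigma_diag (l : Nseq n) : sigma (Theta_diag l) = (\sum_(1 <= i < n.+1) l i%:Z)%N.
Proof.
apply: eq_bigr => i _; rewrite (fsbig_superset (D := [:: i%:Z])) //.
  by rewrite big_seq1 /= eqxx.
by move=> j _ /=; case: (eqVneq i%:Z j) => [->|//]; rewrite inE eqxx.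
Qed.

Lemma diag_Theta_r (l : Nseq n) : Lambda r l -> Theta_r r (Theta_diag l).
Proof. by rewrite /Theta_r /= sigma_diag. Qed.

Lemma Theta_diag_inj : injective (@Theta_diag n).
Proof.
move=> l m e; apply: Nseq_eq => i.
by have := congr1 (fun A : Theta n => A i i) e; rewrite /= eqxx.
Qed.

Definition lmax f g (k : 'I_r) : int := Num.max (f k) (g k).

Lemma lmat_maxr_upper f g i j : i < j -> lmat f (lmax f g) i j = lmat f g i j.
Proof.
move=> ij; rewrite !lmatE; apply: eq_bigr => k _; rewrite /lmax.
by congr (nat_of_bool (_ && _)); lia.
Qed.

Lemma lmat_maxr_lower f g i j : j < i -> lmat f (lmax f g) i j = 0%N.
Proof.
move=> ij; rewrite lmatE; apply: big1 => k _; rewrite /lmax.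
by rewrite (_ : (_ == _) = false) //; lia.
Qed.

Lemma lmaxC f g : lmax f g = lmax g f.
Proof. by apply: funext => k; rewrite /lmax maxC. Qed.

Lemma lmat_maxl_lower f g i j : j < i -> lmat (lmax f g) g i j = lmat f g i j.
Proof.
by move=> ij; have := lmat_maxr_upper g f ij; rewrite -!(lmat_tr _ g) lmaxC.
Qed.

Lemma lmat_maxl_upper f g i j : i < j -> lmat (lmax f g) g i j = 0%N.
Proof.
by move=> ij; have := lmat_maxr_lower g f ij; rewrite -!(lmat_tr _ g) lmaxC.
Qed.

(** X = lmat f h and Y = lmat h g share with lmat f g the part above, resp. below,
    the diagonal, and X also has its row sums. *)
Lemma lmat_max_inj f g f' g' : lmat f (lmax f g) = lmat f' (lmax f' g') ->
  lmat (lmax f g) g = lmat (lmax f' g') g' -> lmat f g = lmat f' g'.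
Proof.
move=> eX eY; apply: lmat_offdiag_inj.
  move=> i j; case: (ltgtP i j) => // ij _.
    by rewrite -(lmat_maxr_upper _ _ ij) eX lmat_maxr_upper.
  by rewrite -(lmat_maxl_lower _ _ ij) eY lmat_maxl_lower.
apply: Nseq_eq => i; rewrite -(lmat_row f (lmax f g)) eX.
exact: lmat_row.
Qed.

Hypothesis n0 : (0 < n)%N.

Lemma sum_dg f : (\sum_(1 <= i < n.+1) dg f i%:Z)%N = r.
Proof.
rewrite /= exchange_big /= -[RHS]card_ord -sum1_card; apply: eq_bigr => k _.
have [a [t [a1 an e]]] := residue_exists (f k) n0.
rewrite (bigD1_seq a) ?iota_uniq ?mem_index_iota ?a1 ?ltnS //=.
rewrite e opprD addrA subrr sub0r rpredN dvdz_mulr //= big1_seq // => b /andP[ba].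
rewrite mem_index_iota => /andP[b1 bn].
rewrite (_ : (_ %| _)%Z = (n%:Z %| (b%:Z - a%:Z)%R)%Z); last first.
  by rewrite -(dvdz_addMr _ (b%:Z - a%:Z) (- t)); congr (_ %| _)%Z; lia.
by rewrite residue_inj ?a1 ?b1 // (negbTE ba).
Qed.

Lemma dg_Lambda f : Lambda r (dg f).
Proof. exact: sum_dg. Qed.

Lemma lmat_Theta_r f g : Theta_r r (lmat f g).
Proof.
rewrite /Theta_r /= /sigma -[RHS](sum_dg f); apply: eq_bigr => i _.
exact: lmat_row.
Qed.

(** The labels list the nonzero entries of the rows 1, ..., n with multiplicity. *)
Lemma lmat_exists (A : Theta n) : Theta_r r A ->
  exists f g, (forall k, 1 <= f k <= n%:Z) /\ A = lmat f g.
Proof.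
move=> hA; have [_ rA _] := thetaP A.
pose R (i : nat) : seq int := fset_set [set j | A i%:Z j != 0].
pose s : seq (int * int) :=
  flatten [seq flatten [seq nseq (A i%:Z j) (i%:Z, j) | j <- R i] | i <- index_iota 1 n.+1].
have Rin i j : A i%:Z j != 0 -> j \in R i.
  by move=> h; rewrite in_fset_set ?inE //; apply: rA.
have big_s (G : int * int -> nat) :
    (\sum_(x <- s) G x)%N = (\sum_(1 <= i < n.+1) \sum_(j <- R i) A i%:Z j * G (i%:Z, j))%N.
  rewrite /s big_flatten big_map; apply: eq_bigr => i _.
  rewrite big_flatten big_map; apply: eq_bigr => j _.
  by rewrite big_nseq iter_addn_0 mulnC.
have ss : size s = r.
  rewrite -hA /sigma -sum1_size big_s; apply: eq_bigr => i _.
  rewrite (fsbig_superset (D := R i)) ?fset_uniq //; last by move=> j _; apply: Rin.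
  by apply: eq_bigr => j _; rewrite muln1.
have sR x : x \in s -> 1 <= x.1 <= n%:Z.
  move=> /flattenP[_ /mapP[i + ->]]; rewrite mem_index_iota => hi.
  by move=> /flattenP[_ /mapP[j _ ->]]; rewrite mem_nseq => /andP[_ /eqP ->] /=; lia.
exists (fun k => (nth (0, 0) s k).1), (fun k => (nth (0, 0) s k).2); split.
  by move=> k; apply: sR; rewrite mem_nth // ss.
apply: Theta_eq => i j; rewrite /=.
transitivity (\sum_(x <- s) Etri n x.1 x.2 i j)%N; last first.
  by rewrite (big_nth (0, 0)) big_mkord ss.
have [a [t [a1 an e]]] := residue_exists i n0.
rewrite big_s (bigD1_seq a) ?iota_uniq ?mem_index_iota ?a1 ?ltnS //=.
rewrite [X in (_ + X)%N]big1_seq ?addn0; last first.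
  move=> b /andP[ba]; rewrite mem_index_iota => /andP[b1 bn].
  rewrite big1 // => l _; rewrite /Etri_fun (_ : (_ %| _)%Z = false) ?andbF ?muln0 //.
  rewrite (_ : i - b%:Z = a%:Z - b%:Z + n%:Z * t) ?dvdz_addMr; last lia.
  by rewrite residue_inj ?a1 ?b1 // eq_sym (negbTE ba).
pose l := j - n%:Z * t.
have -> : A i j = A a%:Z l by rewrite e -[j](subrK (n%:Z * t)) Theta_shift.
have term m : m != l -> (A a%:Z m * Etri_fun n a%:Z m i j)%N = 0%N.
  rewrite /l => hm; rewrite /Etri_fun (_ : (_ == _) = false) ?muln0 //; apply/negbTE.
  by apply: contraNneq hm; lia.
case: (boolP (l \in R a)) => hl.
  rewrite (bigD1_seq l) ?fset_uniq //= [X in (_ + X)%N]big1 ?addn0; last first.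
    by move=> m; apply: term.
  rewrite /Etri_fun (_ : _ && _) ?muln1 // e /l.
  by apply/andP; split; [apply/eqP; lia | rewrite addrAC subrr add0r dvdz_mulr].
rewrite big1_seq; last by move=> m /= hm; apply: term; apply: contraNneq hl => <-.
by apply/eqP; apply: contraNT hl; apply: Rin.
Qed.

Definition banded (w : nat) (A : Theta n) :=
  forall i j : int, A i j != 0%N -> `|i - j| <= w%:Z.

Lemma Theta_r_banded (A : Theta n) : Theta_r r A -> exists w, banded w A.
Proof.
move=> /lmat_exists[f [g [_ ->]]]; exists (\sum_k `|f k - g k|%N)%N => i j.
move=> /lmat_supp[k e]; have -> : i - j = f k - g k by lia.
by rewrite (bigD1 k) //=; lia.
Qed.

(** A banded matrix of size r has r labels f k in 1, ..., n, at distance at most w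
    from the labels g k. *)
Lemma finite_banded w : finite_set [set A : Theta n | Theta_r r A /\ banded w A].
Proof.
pose lab (x : {ffun 'I_r -> 'I_n.+1 * 'I_(w + w).+1}) : Theta n :=
  lmat (fun k => (x k).1%:Z) (fun k => (x k).1%:Z + (x k).2%:Z - w%:Z).
apply: (@sub_finite_set _ _ (lab @` setT)); last exact: finite_image.
move=> A /= [/lmat_exists[f [g [hf ->]]] bA].
exists [ffun k => (inord (absz (f k)), inord (absz (g k - f k + w%:Z)))] => //.
rewrite /lab; congr lmat; apply: funext => k; rewrite ffunE /= inordK.
all: have := hf k; have := bA _ _ (lmat_label f g k); try lia.
by move=> h1 h2; rewrite inordK; lia.
Qed.

End LabelMatrix.

(** * Standard lattices and flags *)

Section Laurent.
Variable F : idomainType.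
Implicit Types (a b : laurent F) (p q : {poly F}) (s t : int).

Let X0 : tofrac ('X : {poly F}) != 0 := fracX_neq0 F.

Lemma lpoly_is_zmod : zmod_morphism (@lpoly F).
Proof. by move=> p q; apply: val_inj; rewrite /= rmorphB. Qed.

Lemma lpoly_is_monoid : monoid_morphism (@lpoly F).
Proof. by split=> [|p q]; apply: val_inj; rewrite /= (rmorph1, rmorphM). Qed.

HB.instance Definition _ :=
  GRing.isZmodMorphism.Build _ _ (@lpoly F) lpoly_is_zmod.
HB.instance Definition _ :=
  GRing.isMonoidMorphism.Build _ _ (@lpoly F) lpoly_is_monoid.

Lemma lpoly_inj : injective (@lpoly F).
Proof. by move=> p q /(congr1 val) /eqP; rewrite tofrac_eq => /eqP. Qed.

Lemma lvarzD s t : lvarz F (s + t) = lvarz F s * lvarz F t.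
Proof. by apply: val_inj; rewrite /= expfzDr. Qed.

Lemma lvarz_nat (m : nat) : lvarz F m%:Z = lpoly 'X^m.
Proof. by apply: val_inj; rewrite /= rmorphXn. Qed.

Lemma lvarz0 : lvarz F 0 = 1.
Proof. by apply: val_inj. Qed.

Lemma lvarzK s : lvarz F s * lvarz F (- s) = 1.
Proof. by rewrite -lvarzD subrr lvarz0. Qed.

Lemma lvarzI s : injective ( *%R (lvarz F s)).
Proof.
apply: (can_inj (g := *%R (lvarz F (- s)))) => a.
by rewrite mulrA [_ * lvarz F s]mulrC lvarzK mul1r.
Qed.

Lemma laurent_exists a : exists (m : nat) q, lpoly 'X^m * a = lpoly q.
Proof.
case: a => a ha; have /asboolP[p [m e]] := ha; exists m, p; apply: val_inj.
transitivity (tofrac ('X^m : {poly F}) * a); first by [].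
rewrite (rmorphXn (@tofrac _)) e mulrCA divff; first exact: mulr1.
exact: expf_neq0.
Qed.

(** The order of a at X = 0 is at least s. *)
Definition ordge s a := exists q, a = lvarz F s * lpoly q.

Lemma ordge0 s : ordge s 0.
Proof. by exists 0; rewrite rmorph0 mulr0. Qed.

Lemma ordgeD s a b : ordge s a -> ordge s b -> ordge s (a + b).
Proof. by move=> [p ->] [q ->]; exists (p + q); rewrite rmorphD mulrDr. Qed.

Lemma ordgeN s a : ordge s a -> ordge s (- a).
Proof. by move=> [p ->]; exists (- p); rewrite rmorphN mulrN. Qed.

Lemma ordgeM s p a : ordge s a -> ordge s (lpoly p * a).
Proof. by move=> [q ->]; exists (p * q); rewrite rmorphM mulrCA. Qed.

Lemma ordge_le s t a : s <= t -> ordge t a -> ordge s a.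
Proof.
move=> st [q ->]; exists ('X^(absz (t - s)) * q).
by rewrite rmorphM /= mulrA -lvarz_nat -lvarzD; congr (lvarz F _ * _); lia.
Qed.

Lemma ordge_max s t a : ordge (Num.max s t) a <-> ordge s a /\ ordge t a.
Proof.
split=> [h|[hs ht]]; first by split; apply: ordge_le h; lia.
by case: (leP s t).
Qed.

Lemma ordge_mulX s a : ordge (s + 1) (lpoly 'X * a) <-> ordge s a.
Proof.
have e1 : lvarz F 1 = lpoly 'X by rewrite (lvarz_nat 1) expr1.
split=> -[q e]; exists q; last by rewrite e lvarzD e1 mulrCA mulrA.
by apply: (@lvarzI 1); rewrite e1 e lvarzD e1 mulrAC mulrC.
Qed.

(** Subtracting the coefficient of X^s raises the order; this coefficient is the
    value at 0 of the polynomial X^(-s) a. *)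
Lemma ordge_coef s a : ordge s a ->
  exists c : F, ordge (s + 1) (a - lpoly c%:P * lvarz F s).
Proof.
move=> [q ->]; exists q.[0].
have /factor_theorem[u hu] : root (q - q.[0]%:P) 0 by rewrite rootE !hornerE subrr.
exists u; rewrite mulrC -mulrBl -rmorphB hu polyC0 subr0 lvarzD (lvarz_nat 1) expr1.
by rewrite rmorphM /=; ring.
Qed.

Lemma ordge_const s (c : F) : ordge (s + 1) (lpoly c%:P * lvarz F s) -> c = 0.
Proof.
move=> [q]; rewrite lvarzD (lvarz_nat 1) expr1 mulrC -mulrA => /lvarzI.
rewrite -rmorphM => /lpoly_inj /(congr1 (horner^~ 0)).
by rewrite !hornerE.
Qed.

End Laurent.

Section StandardLattices.
Variables (F : fieldType) (r : nat).

(** The space of rows of Laurent polynomials, as a vector space over F. *)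
Definition vecs := 'rV[laurent F]_r.
HB.instance Definition _ := GRing.Zmodule.on vecs.

Definition vecs_scale (c : F) (v : vecs) : vecs := lpoly c%:P *: (v : Vr r F).

Fact vecs_scaleA a b v : vecs_scale a (vecs_scale b v) = vecs_scale (a * b) v.
Proof. by rewrite /vecs_scale scalerA -rmorphM -polyCM. Qed.
Fact vecs_scale1 : left_id 1 vecs_scale.
Proof. by move=> v; rewrite /vecs_scale rmorph1 scale1r. Qed.
Fact vecs_scaleDr : right_distributive vecs_scale +%R.
Proof. by move=> c u v; rewrite /vecs_scale scalerDr. Qed.
Fact vecs_scaleDl v : {morph vecs_scale^~ v : a b / a + b}.
Proof. by move=> a b; rewrite /vecs_scale polyCD rmorphD scalerDl. Qed.

HB.instance Definition _ := GRing.Zmodule_isLmodule.Build F vecs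
  vecs_scaleA vecs_scale1 vecs_scaleDr vecs_scaleDl.

(** The scalar action is chosen so that this holds by computation. *)
Lemma quot_dimE (X Y : set (Vr r F)) d :
  quot_dim X Y d = qdim (X : set vecs) (Y : set vecs) d.
Proof. by []. Qed.

(** The lattice spanned over F[X] by the X^(h k) times the k-th basis vector. *)
Definition std (h : 'I_r -> int) : set vecs :=
  [set x | forall k, ordge (h k) (x 0 k)].

Lemma scaleE c (v : vecs) k : (c *: v) 0 k = lpoly c%:P * v 0 k.
Proof. by rewrite /GRing.scale /= /vecs_scale mxE. Qed.

Lemma std_le h h' : (forall k, h k <= h' k) -> std h' `<=` std h.
Proof. by move=> hh x hx k; apply: ordge_le (hx k). Qed.

Lemma std_cap h h' : std h `&` std h' = std (lmax h h').
Proof.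
apply/seteqP; split=> x /=.
  by move=> [h1 h2] k; apply/ordge_max; split; [apply: h1 | apply: h2].
by move=> H; split=> k; have /ordge_max[] := H k.
Qed.

(** Each coordinate may be assigned to the summand that allows the smaller order. *)
Lemma std_sum h h' :
  sumset (std h) (std h') = std (fun k => Num.min (h k) (h' k)).
Proof.
apply/seteqP; split=> x /=.
  move=> [y hy [z hz <-]] k; rewrite mxE; apply: ordgeD.
    by apply: ordge_le (hy k); lia.
  by apply: ordge_le (hz k); lia.
move=> hx; exists (\row_k if h k <= h' k then x 0 k else 0).
  by move=> k; rewrite mxE; case: leP (hx k) => // _ _; apply: ordge0.
exists (\row_k if h k <= h' k then 0 else x 0 k).
  by move=> k; rewrite mxE; case: leP (hx k) => // _ _; apply: ordge0.
by apply/rowP => k; rewrite !mxE; case: ifP; rewrite (addr0, add0r).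
Qed.

Lemma std_lattice h : is_lattice (std h).
Proof.
pose b k : Vr r F := lvarz F (h k) *: delta_mx 0 k.
have bE (c : 'I_r -> laurent F) k : (\sum_i c i *: b i) 0 k = c k * lvarz F (h k).
  rewrite summxE (bigD1 k) //= big1.
    by rewrite !mxE !eqxx mulr1 addr0.
  move=> i ik.
  by rewrite !mxE [k == i]eq_sym (negbTE ik) andbF !mulr0.
exists b; split.
- apply/seteqP; split=> x /=.
    move=> /choice[q hq]; exists q => //; apply/rowP => k.
    by rewrite bE hq mulrC.
  by move=> [q _ <-] k; rewrite bE; exists (q k); rewrite mulrC.
- move=> q q' /rowP e; apply: funext => k; move: (e k).
  by rewrite !bE mulrC [RHS]mulrC => /lvarzI /lpoly_inj.
- move=> x; exists (fun k => x 0 k * lvarz F (- h k)); apply/rowP => k.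
  by rewrite bE -mulrA [lvarz F _ * _]mulrC lvarzK mulr1.
Qed.

(** Raising the order of the coordinates in K by one costs one leading
    coefficient per element of K. *)
Lemma std_step h (K : {set 'I_r}) :
  qdim (std h) (std (fun k => h k + (k \in K)%:Z)) #|K|.
Proof.
pose x (j : 'I_#|K|) : vecs := lvarz F (h (enum_val j)) *: (delta_mx 0 (enum_val j) : Vr r F).
have xE (c : 'I_#|K| -> F) j :
    (\sum_i c i *: x i) 0 (enum_val j) = lpoly (c j)%:P * lvarz F (h (enum_val j)).
  rewrite summxE (bigD1 j) //= big1.
    by rewrite scaleE !mxE !eqxx mulr1 addr0.
  move=> i ij.
  rewrite scaleE !mxE (inj_eq enum_val_inj) [j == i]eq_sym (negbTE ij) andbF.
  by rewrite !mulr0.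
have x0 (c : 'I_#|K| -> F) k : k \notin K -> (\sum_i c i *: x i) 0 k = 0.
  move=> kK; rewrite summxE big1 // => i _; rewrite scaleE !mxE.
  rewrite (_ : (k == _) = false) ?andbF ?mulr0 //.
  by apply: contraNF kK => /eqP ->; apply: enum_valP.
have subE (u v : vecs) k : (u - v) 0 k = u 0 k - v 0 k by rewrite !mxE.
exists x; split.
  move=> j k; rewrite !mxE eqxx; case: eqP => [->|_]; last by rewrite mulr0; apply: ordge0.
  by exists 1; rewrite (rmorph1 (@lpoly F)) /=.
move=> z hz.
have /choice[c hc] : forall j : 'I_#|K|, exists c : F,
    ordge (h (enum_val j) + 1) (z 0 (enum_val j) - lpoly c%:P * lvarz F (h (enum_val j))).
  by move=> j; apply: ordge_coef.
exists c; split.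
  move=> k; rewrite subE; case: (boolP (k \in K)) => kK; last first.
    by rewrite x0 // !subr0; apply: hz.
  by have := hc (enum_rank_in kK k); rewrite -(xE c) (enum_rankK_in kK kK).
move=> c' hc'; apply: funext => j; apply/eqP; rewrite -subr_eq0; apply/eqP.
apply: (@ordge_const _ (h (enum_val j))).
have := hc' (enum_val j); rewrite subE xE enum_valP => h1.
have := ordgeD h1 (ordgeN (hc j)).
rewrite (_ : _ + _ = lpoly (c j - c' j)%:P * lvarz F (h (enum_val j))) //.
by rewrite polyCB rmorphB mulrBl; ring.
Qed.

End StandardLattices.

Section StandardFlags.
Variables (F : fieldType) (n r : nat).
Implicit Types (f g : 'I_r -> int) (i j : int).

(** X^s times the k-th basis vector lies in the i-th lattice when
    f k - n s <= i; the least such s is minus the floor of (i - f k) / n. *)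
Definition deg f (i : int) (k : 'I_r) : int := - ((i - f k) %/ n%:Z)%Z.

Definition sflag f (i : int) : set (Vr r F) := std (deg f i).

Lemma deg_max f g i k : deg (lmax f g) i k = Num.max (deg f i k) (deg g i k).
Proof.
have mono (a b : int) : a <= b -> (a %/ n%:Z <= b %/ n%:Z)%Z.
  by apply: lez_pdiv2r.
rewrite /deg /lmax; case: (leP (f k) (g k)) => h.
  have := mono (i - g k) (i - f k) ltac:(lia); lia.
have := mono (i - f k) (i - g k) ltac:(lia); lia.
Qed.

Lemma sflag_cap f g i : sflag f i `&` sflag g i = sflag (lmax f g) i.
Proof.
by rewrite /sflag std_cap; congr std; apply: funext => k; rewrite deg_max.
Qed.

Hypothesis n0 : (0 < n)%N.

(** The floor of (i - f k) / n jumps exactly at the multiples of n. *)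
Lemma deg_pred f i k : deg f (i - 1) k = deg f i k + (n%:Z %| (i - f k)%R)%Z%:Z.
Proof.
rewrite /deg; have e := divz_eq (i - f k) n%:Z; have e' := divz_eq (i - 1 - f k) n%:Z.
have nz : n%:Z != 0 by lia.
have p0 : 0 < n%:Z by lia.
have := modz_ge0 (i - f k) nz; have := ltz_pmod (i - f k) p0.
have := modz_ge0 (i - 1 - f k) nz; have := ltz_pmod (i - 1 - f k) p0.
move: e e'; have := @dvdz_mod0P n%:Z (i - f k).
set a := ((i - f k) %/ _)%Z; set b := ((i - 1 - f k) %/ _)%Z.
set u := ((i - f k) %% _)%Z; set v := ((i - 1 - f k) %% _)%Z.
case=> hu e e' h1 h2 h3 h4.
  suff : b = a - 1 by lia.
  have : b = a - 1 \/ b <= a - 2 \/ a <= b by lia.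
  by case=> [//|[h|h]]; nia.
suff : b = a by lia.
have u0 : 0 < u by lia.
have : b = a \/ b <= a - 1 \/ a + 1 <= b by lia.
by case=> [//|[h|h]]; nia.
Qed.

Lemma deg_shift f i k : deg f (i - n%:Z) k = deg f i k + 1.
Proof.
rewrite /deg (_ : i - n%:Z - f k = (-1) * n%:Z + (i - f k)); last by ring.
by rewrite divzMDl; lia.
Qed.

Lemma sflag_flag f : is_flag n (sflag f).
Proof.
split=> i; first exact: std_lattice.
  by apply: std_le => k; rewrite deg_pred; lia.
apply/seteqP; split=> x /=.
  move=> hx; exists (lvarz F (-1) *: (x : Vr r F)); last first.
    by rewrite scalerA -[X in lpoly X]expr1 -lvarz_nat lvarzK scale1r.
  move=> k; have := hx k; rewrite deg_shift mxE => h.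
  by apply/ordge_mulX; rewrite mulrA -[X in lpoly X]expr1 -lvarz_nat lvarzK mul1r.
by move=> [y hy <-] k; rewrite deg_shift mxE; apply/ordge_mulX; apply: hy.
Qed.

(** The quotient defining the (i, j) entry is again a quotient of standard
    lattices; the orders of its k-th coordinates differ, and then by one, when
    X^s times the k-th basis vector has degrees exactly i and j for some s. *)
Lemma sflag_rel_pos f g : rel_pos (sflag f) (sflag g) (lmat n f g).
Proof.
move=> i j; rewrite quot_dimE.
pose K := [set k | (i - f k == j - g k) && (n%:Z %| i - f k)%Z]%SET.
have -> : lmat n f g i j = #|K|.
  by rewrite lmatE -sum1_card [RHS]big_mkcond; apply: eq_bigr => k _; rewrite inE; case: ifP.
rewrite /sflag !std_cap.
rewrite [X in qdim _ X](_ : _ =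
    std (fun k => lmax (deg f i) (deg g j) k + (k \in K)%:Z)).
  exact: std_step.
transitivity (std (F := F) (fun k =>
    Num.min (lmax (deg f (i - 1)) (deg g j) k) (lmax (deg f i) (deg g (j - 1)) k))).
  exact: (std_sum F (lmax (deg f (i - 1)) (deg g j)) (lmax (deg f i) (deg g (j - 1)))).
congr std; apply: funext => k; rewrite /lmax !deg_pred inE.
have ef := divz_eq (i - f k) n%:Z; have eg := divz_eq (j - g k) n%:Z.
have hf := @dvdz_mod0P n%:Z (i - f k); have hg := @dvdz_mod0P n%:Z (j - g k).
have hd : deg f i k = - ((i - f k) %/ n%:Z)%Z by [].
have hd' : deg g j k = - ((j - g k) %/ n%:Z)%Z by [].
(* only when n divides both i - f k and j - g k can both orders increase *)
case: hf => hf; last by rewrite andbF; lia.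
case: hg => hg; last first.
  case: eqP => [e|_]; first by rewrite -e in hg.
  by rewrite /=; lia.
rewrite andbT; case: eqP => e.
  by rewrite hd hd' e; lia.
suff : deg f i k <> deg g j k by rewrite /=; lia.
by rewrite hd hd' => /oppr_inj e'; apply: e; rewrite ef eg hf hg e'.
Qed.

End StandardFlags.

(** * Relative positions of arbitrary flags *)

Section Flags.
Variables (F : fieldType) (n r : nat).
Implicit Types (L M : int -> set (Vr r F)) (A B : Theta n) (i j : int).

Lemma lattice_subspace (L : set (Vr r F)) : is_lattice L -> subspace (L : set (vecs F r)).
Proof.
move=> [b [-> _ _]]; split.
  by exists (fun=> 0) => //; rewrite big1 // => k _; rewrite rmorph0 scale0r.
move=> c _ _ [q _ <-] [q' _ <-]; exists (fun k => c%:P * q k + q' k) => //.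
transitivity (lpoly c%:P *: (\sum_k lpoly (q k) *: b k) +
              \sum_k lpoly (q' k) *: b k); last by [].
rewrite scaler_sumr -big_split.
by apply: eq_bigr => k _; rewrite /= rmorphD rmorphM scalerDl scalerA.
Qed.

(** X^N clears the denominators of the finitely many coordinates of a basis of L
    on a basis of L'. *)
Lemma lattice_commensurable (L L' : set (Vr r F)) : is_lattice L -> is_lattice L' ->
  exists N : nat, forall x, L x -> L' (lpoly 'X^N *: x).
Proof.
move=> [b [-> _ _]] [b' [-> _ span']].
have /choice[c hc] : forall k, exists c : 'I_r -> laurent F, b k = \sum_l c l *: b' l.
  by move=> k; apply: span'.
have /choice[e he] : forall ki : 'I_r * 'I_r, exists m : nat, exists q,
    lpoly 'X^m * c ki.1 ki.2 = lpoly q by move=> ki; apply: laurent_exists.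
pose N := (\max_ki e ki)%N; exists N.
have /choice[q hq] : forall ki : 'I_r * 'I_r, exists q,
    lpoly 'X^N * c ki.1 ki.2 = lpoly q.
  move=> ki; have [q hq] := he ki; exists ('X^(N - e ki) * q).
  rewrite rmorphM /= -hq mulrA -rmorphM -exprD subnK //.
  exact: (leq_bigmax ki).
move=> _ [u _ <-]; exists (fun l => \sum_k u k * q (k, l)) => //.
rewrite scaler_sumr.
under [RHS]eq_bigr => k _ do rewrite scalerA mulrC -scalerA hc scaler_sumr scaler_sumr.
rewrite [RHS]exchange_big; apply: eq_bigr => l _.
rewrite rmorph_sum scaler_suml; apply: eq_bigr => k _.
by rewrite rmorphM /= -hq !scalerA mulrA.
Qed.

Lemma flag_subspace L i : is_flag n L -> subspace (L i : set (vecs F r)).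
Proof. by move=> [/(_ i) h _ _]; apply: lattice_subspace. Qed.

Lemma flag_le L i j : is_flag n L -> i <= j -> L i `<=` L j.
Proof.
move=> [_ h _] ij; have -> : j = i + (absz (j - i))%:Z by lia.
elim: (absz _) => [|m IH]; first by rewrite addr0.
apply: subset_trans IH _; have := h (i + m.+1%:Z).
by rewrite (_ : i + m.+1%:Z - 1 = i + m%:Z) //; lia.
Qed.

Lemma flag_shift L i (m : nat) : is_flag n L ->
  L (i - n%:Z * m%:Z) = [set lpoly 'X^m *: x | x in L i].
Proof.
move=> [_ _ h]; elim: m => [|m IH].
  by rewrite mulr0 subr0 expr0 rmorph1; apply/seteqP; split=> x /=;
    [exists x; rewrite ?scale1r | move=> [y hy <-]; rewrite scale1r].
have -> : i - n%:Z * m.+1%:Z = i - n%:Z * m%:Z - n%:Z by rewrite -addn1 PoszD; ring.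
rewrite h IH; apply/seteqP; split=> x /=.
  by move=> [_ [y hy <-] <-]; exists y => //; rewrite exprS rmorphM scalerA.
move=> [y hy <-]; exists (lpoly 'X^m *: y); first by exists y.
by rewrite exprS rmorphM scalerA.
Qed.

Lemma scaleXI (m : nat) : injective (fun x : Vr r F => lpoly 'X^m *: x).
Proof.
move=> x y /(congr1 (fun z : Vr r F => lvarz F (- m%:Z) *: z)).
by rewrite !scalerA -lvarz_nat mulrC lvarzK !scale1r.
Qed.

Lemma flag_mulX L i (m : nat) x : is_flag n L ->
  L (i - n%:Z * m%:Z) (lpoly 'X^m *: x) <-> L i x.
Proof.
move=> hL; rewrite flag_shift //; split; last by exists x.
by move=> [y hy /scaleXI <-].
Qed.

(** A flag is determined by n consecutive lattices. *)
Lemma flag_periodic L L' J (t : int) : is_flag n L -> is_flag n L' ->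
  L J = L' J -> L (J + n%:Z * t) = L' (J + n%:Z * t).
Proof.
move=> hL hL' e; case: t => m; last by rewrite NegzE mulrN !flag_shift // e.
apply/seteqP; split=> x; rewrite -(flag_mulX _ m) // addrK.
  by rewrite e => h; rewrite -(flag_mulX _ m) // addrK.
by rewrite -e => h; rewrite -(flag_mulX _ m) // addrK.
Qed.

Lemma rel_pos_tr L L' A : rel_pos L L' A -> rel_pos L' L (Theta_tr A).
Proof.
move=> h i j; have := h j i; rewrite setIC.
congr quot_dim; apply/seteqP; split=> x [y [y1 y2] [z [z1 z2] <-]].
  by exists z; [|exists y]; rewrite // addrC.
by exists z; [|exists y]; rewrite // addrC.
Qed.

(** The bifiltration attached to a pair of flags. *)
Definition meet L L' i j : set (vecs F r) := L i `&` L' j.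

Lemma meet_subspace L L' i j : is_flag n L -> is_flag n L' -> subspace (meet L L' i j).
Proof. by move=> hL hL'; apply: subspaceI; apply: flag_subspace. Qed.

Lemma rel_posE L L' A i j : rel_pos L L' A ->
  qdim (meet L L' i j) (sumset (meet L L' (i - 1) j) (meet L L' i (j - 1))) (A i j).
Proof. by move=> /(_ i j). Qed.

(** The entries are dimensions of subquotients, hence unique. *)
Lemma rel_pos_inj L L' A B : is_flag n L -> is_flag n L' ->
  rel_pos L L' A -> rel_pos L L' B -> A = B.
Proof.
move=> hL hL' hA hB; apply: Theta_eq => i j.
apply: qdim_inj (rel_posE i j hA) (rel_posE i j hB).
  exact: meet_subspace.
by apply: subspace_sumset; apply: meet_subspace.
Qed.

(** Beyond the band the quotient defining the entry vanishes already because its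
    numerator L_i meet L'_j equals L_(i-1) meet L'_j. *)
Lemma band_rel_pos L L' A (w : nat) : is_flag n L -> is_flag n L' -> rel_pos L L' A ->
  (forall j, L' j `<=` L (j + w%:Z)) -> forall i j, j + w%:Z < i -> A i j = 0%N.
Proof.
move=> hL hL' hA sub i j ij.
apply: qdim_inj (rel_posE i j hA) _; first exact: meet_subspace.
  by apply: subspace_sumset; apply: meet_subspace.
apply: qdim_sub0 => x [x1 x2]; exists x.
  by split=> //; apply: flag_le (sub _ _ x2) => //; lia.
exists 0; last by rewrite addr0.
by case: (meet_subspace i (j - 1) hL hL').
Qed.

(** The sum of the entries in the w by w square with lower left corner (J, J + 1);
    for w large this is the sum over the whole quadrant i <= J < j. *)
Definition corner (w : nat) A (J : int) : nat :=
  (\sum_(u < w) \sum_(t < w) A (J - t%:Z)%R (J + 1 + u%:Z)%R)%N.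

(** Refining the quotient by the bifiltration, the entries of A in the quadrant
    i <= J < j are the dimensions of the pieces of L_J / (L_J meet L'_J). *)
Lemma rel_pos_corner L L' A (w : nat) : is_flag n L -> is_flag n L' -> rel_pos L L' A ->
  (forall i, L i `<=` L' (i + w%:Z)) -> forall J,
  qdim (L J : set (vecs F r)) (meet L L' J J) (corner w A J).
Proof.
move=> hL hL' hA sub J.
have sM := meet_subspace _ _ hL hL'.
(* the second isomorphism theorem moves the filtration one step down in i *)
have column (m : nat) i j : L (i - m%:Z) `<=` L' (j - 1) ->
    qdim (meet L L' i j) (meet L L' i (j - 1)) (\sum_(t < m) A (i - t%:Z)%R j)%N.
  elim: m i => [|m IH] i h.
    rewrite big_ord0; apply: qdim_sub0 => x [x1 x2]; split=> //; apply: h.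
    by rewrite subr0.
  rewrite big_ord_recl subr0.
  apply: (@qdim_trans _ _ _ (sumset (meet L L' (i - 1) j) (meet L L' i (j - 1)))) => //.
  - exact: subspace_sumset.
  - move=> x hx; exists 0; first by case: (sM (i - 1) j).
    by exists x => //; rewrite add0r.
  - move=> _ [y [y1 y2] [z [z1 z2] <-]]; apply: subspaceD => //.
      by split=> //; apply: flag_le y1 => //; lia.
    by split=> //; apply: flag_le z2 => //; lia.
  - exact: rel_posE.
  - apply: qdim_sumset => //.
    rewrite (_ : _ `&` _ = meet L L' (i - 1) (j - 1)).
      rewrite [X in qdim _ _ X](_ : _ = \sum_(t < m) A (i - 1 - t%:Z)%R j)%N.
        by apply: IH => x hx; apply: h; rewrite (_ : i - m.+1%:Z = i - 1 - m%:Z) //; lia.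
      by apply: eq_bigr => t _; congr (A _ _); rewrite /= /bump /=; lia.
    apply/seteqP; split=> x; first by move=> [[? ?] [? ?]].
    move=> [x1 x2]; split; split=> //.
      by apply: flag_le x2 => //; lia.
    by apply: flag_le x1 => //; lia.
have rows (m : nat) : qdim (meet L L' J (J + m%:Z)) (meet L L' J J)
    (\sum_(u < m) \sum_(t < w) A (J - t%:Z)%R (J + 1 + u%:Z)%R)%N.
  elim: m => [|m IH]; first by rewrite big_ord0 addr0; apply: qdim_sub0.
  rewrite big_ord_recr /= addnC.
  apply: (@qdim_trans _ _ _ (meet L L' J (J + m%:Z))) => //.
  - by move=> x [x1 x2]; split=> //; apply: flag_le x2 => //; lia.
  - by move=> x [x1 x2]; split=> //; apply: flag_le x2 => //; lia.
  have -> : J + m.+1%:Z = J + 1 + m%:Z by lia.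
  have e : J + m%:Z = J + 1 + m%:Z - 1 by lia.
  rewrite [X in qdim _ (meet L L' J X)]e; apply: column.
  by move=> x /sub; apply: flag_le => //; lia.
have := rows w; congr qdim; apply/seteqP; split=> x; first by case.
by move=> hx; split=> //; apply: sub.
Qed.

Hypothesis n0 : (0 < n)%N.

(** Commensurability of the lattices in degree 0 propagates with a uniform bound
    by periodicity. *)
Lemma flag_commensurable L L' : is_flag n L -> is_flag n L' ->
  exists w : nat, forall i, L i `<=` L' (i + w%:Z).
Proof.
move=> hL hL'; have [lL _ _] := hL; have [lL' _ _] := hL'.
have [N hN] := lattice_commensurable (lL 0) (lL' 0).
have base x : L 0 x -> L' (n%:Z * N%:Z) x.
  by move=> /hN h; rewrite -(flag_mulX _ N) // subrr.
have step (c : int) x : L (n%:Z * c) x -> L' (n%:Z * c + n%:Z * N%:Z) x.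
  case: c => m.
    move=> h; rewrite -(flag_mulX _ m) // addrAC subrr add0r; apply: base.
    by rewrite -[0](subrr (n%:Z * m%:Z)) flag_mulX.
  rewrite NegzE mulrN -sub0r flag_shift // => -[y /base hy <-].
  by rewrite sub0r addrC flag_mulX.
exists (n + n * N)%N => i x hx.
have e := divz_eq i n%:Z; have nz : n%:Z != 0 by lia.
have h1 := modz_ge0 i nz; have h2 := ltz_pmod i (_ : 0 < n%:Z).
move: e h1 (h2 n0); set c := (i %/ _)%Z; set u := (i %% _)%Z => e h1 h3.
apply: (@flag_le L' (n%:Z * (c + 1) + n%:Z * N%:Z)) => //; first by rewrite PoszD PoszM; nia.
by apply: step; apply: flag_le hx => //; nia.
Qed.

(** A zero entry says that L_i meet L'_j is the sum of L_(i-1) meet L'_j and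
    L_i meet L'_(j-1).  Iterating on the second summand until L'_(j-m) is inside
    L_(i-1) gives L_i meet L'_j inside L_(i-1); then i decreases down to j + w. *)
Lemma rel_pos_band L L' A (w : nat) : is_flag n L -> is_flag n L' -> rel_pos L L' A ->
  (forall i j, j + w%:Z < i -> A i j = 0%N) -> forall j, L' j `<=` L (j + w%:Z).
Proof.
move=> hL hL' hA A0.
have [v hv] := flag_commensurable hL' hL.
have drop (m : nat) i j : j + w%:Z < i -> L' (j - m%:Z) `<=` L (i - 1) ->
    L i `&` L' j `<=` L (i - 1).
  elim: m j => [|m IH] j ij sub x [x1 x2]; first by apply: sub; rewrite subr0.
  have := rel_posE i j hA; rewrite A0 // => /qdim0_sub /(_ x) [//|y [y1 _] [z [z1 z2] <-]].
  apply: subspaceD (flag_subspace _ hL) y1 _; apply: (IH (j - 1)) => //; first by lia.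
  by rewrite (_ : j - 1 - m%:Z = j - m.+1%:Z) //; lia.
move=> j; have : L' j `<=` L (j + w%:Z + v%:Z).
  by move=> x /hv; apply: flag_le => //; lia.
elim: v {hv} => [|u IH] hj; first by rewrite -[X in L X]addr0.
apply: IH; move=> x hx.
have -> : j + w%:Z + u%:Z = j + w%:Z + u.+1%:Z - 1 by lia.
have [v hv] := flag_commensurable hL' hL.
apply: (@drop v _ j); first by lia.
  by move=> y /hv; apply: flag_le => //; lia.
by split => //; apply: hj.
Qed.

Lemma rel_pos_upper L L' A : is_flag n L -> is_flag n L' -> rel_pos L L' A ->
  (forall i j, j < i -> A i j = 0%N) -> forall j, L' j `<=` L j.
Proof.
move=> hL hL' hA A0 j; rewrite -[X in L X]addr0.
by apply: (rel_pos_band (w := 0) hL hL' hA) => i' j'; rewrite addr0; apply: A0.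
Qed.

(** A diagonal matrix is upper triangular, and so is its transpose. *)
Lemma rel_pos_diag L L' (l : Nseq n) : is_flag n L -> is_flag n L' ->
  rel_pos L L' (Theta_diag l) -> L' = L.
Proof.
move=> hL hL' hl; apply: funext => i; apply/seteqP; split.
  by apply: rel_pos_upper hl _ i => // i' j' ij /=; case: eqP ij => // ->; lia.
apply: rel_pos_upper (rel_pos_tr hl) _ i => // i' j' ij /=.
by case: eqP ij => // ->; lia.
Qed.

(** L_J / L'_J surjects onto L_J / M_J, and the corner sums are the dimensions of
    these quotients.  By periodicity n consecutive degrees suffice for L' = M. *)
Lemma corner_mono L L' M A B : is_flag n L -> is_flag n L' -> is_flag n M ->
  (forall i, L' i `<=` M i) -> (forall i, M i `<=` L i) ->
  rel_pos L L' A -> rel_pos L M B ->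
  exists w0 : nat, forall w, (w0 <= w)%N ->
    (forall J, (corner w B J <= corner w A J)%N) /\
    ((forall J, 0 <= J < n%:Z -> corner w B J = corner w A J) -> L' = M).
Proof.
move=> hL hL' hM L'M ML hA hB.
have [w1 h1] := flag_commensurable hL hL'.
have [w2 h2] := flag_commensurable hL hM.
exists (maxn w1 w2) => w hw.
have qA J : qdim (L J : set (vecs F r)) (L' J) (corner w A J).
  have := rel_pos_corner hL hL' hA (w := w); rewrite /meet => /(_ _ J).
  rewrite setIidr; last by move=> x /L'M /ML.
  by apply=> i x /h1; apply: flag_le => //; lia.
have qB J : qdim (L J : set (vecs F r)) (M J) (corner w B J).
  have := rel_pos_corner hL hM hB (w := w); rewrite /meet => /(_ _ J).
  rewrite setIidr //.
  by apply=> i x /h2; apply: flag_le => //; lia.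
have mono J := qdim_mono (flag_subspace J hL) (flag_subspace J hL')
  (flag_subspace J hM) (@L'M J) (qA J) (qB J).
split=> [J|eqc]; first by case: (mono J).
apply: funext => i; have [a [t [a1 an e]]] := residue_exists (i + 1) n0.
rewrite (_ : i = a%:Z - 1 + n%:Z * t); last by lia.
apply: flag_periodic => //; apply/seteqP; split; first exact: L'M.
have [_ /(_ (eqc _ _)) sub] := mono (a%:Z - 1).
by move=> x hx; apply: sub; [lia | split => //; apply: ML].
Qed.

End Flags.

(** * Structure constants of the affine Schur algebra *)

Lemma has_card0 T (S : set T) k : S = set0 -> has_card S k -> k = 0%N.
Proof.
move=> ->; rewrite /has_card card_eq_sym => h.
by apply/card_eq_II; apply: card_eq_trans h _; rewrite II0; apply: card_eq00.
Qed.

Lemma has_card1 T (S : set T) x k : S = [set x] -> has_card S k -> k = 1%N.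
Proof.
move=> ->; rewrite /has_card card_eq_sym => h.
by apply/card_eq_II; apply: card_eq_trans h _; apply: card_set1.
Qed.

(** The prime fields already give infinitely many values of q. *)
Lemma poly_const_finFields (P : {poly int}) (c : int) :
  (forall F : finFieldType, P.[#|F|%:Z] = c) -> P = c%:P.
Proof.
move=> hP; apply/eqP; rewrite -subr_eq0; apply: contraT => Pc.
have [s [us ss ps]] : exists s : seq nat,
    [/\ uniq s, size s = size (P - c%:P) & all prime s].
  elim: (size _) => [|m [s [us ss ps]]]; first by exists [::].
  have [q qs pq] := prime_above (\max_(x <- s) x).
  exists (q :: s); rewrite /= ss us ps pq; split=> //; rewrite andbT.
  apply/negP => qin; move: qs; rewrite ltnNge.
  by rewrite (bigD1_seq q) //= leq_maxl.
have := max_poly_roots (rs := map Posz s) Pc; rewrite size_map ss ltnn; apply.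
  apply/allP => _ /mapP[q qs ->]; rewrite rootE !hornerE.
  have pq := allP ps _ qs.
  have := hP 'F_q; rewrite card_ord Fp_cast // => ->.
  by rewrite subrr.
by rewrite map_inj_uniq // => x y [].
Qed.

Section SchurPolynomials.
Variables n r : nat.
Hypothesis n0 : (0 < n)%N.
Variable p : Theta n -> Theta n -> Theta n -> {poly int}.
Hypothesis hp : is_schur_poly r p.
Implicit Types (A B C : Theta n) (f g : 'I_r -> int) (l : Nseq n).

Definition between (F : fieldType) (L L'' : int -> set (Vr r F)) A B
    : set (int -> set (Vr r F)) :=
  [set L' | [/\ is_flag n L', rel_pos L L' A & rel_pos L' L'' B]].

(** The structure constants may be evaluated on standard flags, and the count is
    only needed for the pairs that are themselves standard. *)
Lemma schur_poly_const A B f g (c : nat) : Theta_r r A -> Theta_r r B ->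
  (forall (F : finFieldType) k,
     has_card (between (sflag n (F := F) f) (sflag n g) A B) k -> k = c) ->
  p A B (lmat n f g) = c%:Z%:P.
Proof.
move=> hA hB hc; apply: poly_const_finFields => F.
have [k [hk ->]] := hp hA hB (lmat_Theta_r n0 f g) (sflag_flag F n0 f)
  (sflag_flag F n0 g) (sflag_rel_pos F n0 f g).
by rewrite (hc F k hk).
Qed.

Lemma schur_poly_neq0 A B f g : Theta_r r A -> Theta_r r B ->
  p A B (lmat n f g) != 0 ->
  exists (F : finFieldType) L', between (sflag n (F := F) f) (sflag n g) A B L'.
Proof.
move=> hA hB /eqP pn0; apply: contrapT => h; apply: pn0.
rewrite -[RHS]/(0%:Z%:P); apply: schur_poly_const => // F k.
apply: has_card0; apply/seteqP; split=> // L' hL'.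
by apply: h; exists F, L'.
Qed.

(** The intermediate flag must be the first one. *)
Lemma schur_diag_l l B f g : Lambda r l -> Theta_r r B ->
  p (Theta_diag l) B (lmat n f g) = ((l == dg n f) && (B == lmat n f g))%:Z%:P.
Proof.
move=> hl hB; apply: schur_poly_const => [||F k]; [exact: diag_Theta_r|by []|].
have ff := sflag_flag F n0 f; have fg := sflag_flag F n0 g.
have diag_ff : rel_pos (sflag n (F := F) f) (sflag n f) (Theta_diag (dg n f)).
  by move: (sflag_rel_pos F n0 f f); rewrite lmat_diag.
case: (boolP (_ && _)) => [/andP[/eqP -> /eqP ->]|h].
  apply: (has_card1 (x := sflag n f)); apply/seteqP; split=> L'.
    by move=> [hL' h1 _]; apply: rel_pos_diag h1.
  by move=> ->; split=> //; apply: sflag_rel_pos.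
apply: has_card0; apply/seteqP; split=> // L' [hL' h1 h2].
have eL := rel_pos_diag n0 ff hL' h1; move: h1 h2; rewrite eL => h1 h2.
move: h; rewrite (rel_pos_inj ff fg h2 (sflag_rel_pos F n0 f g)).
by rewrite (Theta_diag_inj (rel_pos_inj ff ff h1 diag_ff)) !eqxx.
Qed.

Lemma schur_diag_r l A f g : Lambda r l -> Theta_r r A ->
  p A (Theta_diag l) (lmat n f g) = ((l == dg n g) && (A == lmat n f g))%:Z%:P.
Proof.
move=> hl hA; apply: schur_poly_const => [||F k]; [by []|exact: diag_Theta_r|].
have ff := sflag_flag F n0 f; have fg := sflag_flag F n0 g.
have diag_gg : rel_pos (sflag n (F := F) g) (sflag n g) (Theta_diag (dg n g)).
  by move: (sflag_rel_pos F n0 g g); rewrite lmat_diag.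
case: (boolP (_ && _)) => [/andP[/eqP -> /eqP ->]|h].
  apply: (has_card1 (x := sflag n g)); apply/seteqP; split=> L'.
    by move=> [hL' _ h2]; apply/esym; apply: rel_pos_diag h2.
  by move=> ->; split=> //; apply: sflag_rel_pos.
apply: has_card0; apply/seteqP; split=> // L' [hL' h1 h2].
have eL := rel_pos_diag n0 hL' fg h2; move: h1 h2; rewrite -eL => h1 h2.
move: h; rewrite (rel_pos_inj ff fg h1 (sflag_rel_pos F n0 f g)).
by rewrite (Theta_diag_inj (rel_pos_inj fg fg h2 diag_gg)) !eqxx.
Qed.

(** [rel_pos_band] and [band_rel_pos] for the pair and for the transposed pair. *)
Lemma rel_pos_banded (F : fieldType) (L L' : int -> set (Vr r F)) A :
  is_flag n L -> is_flag n L' -> Theta_r r A -> rel_pos L L' A ->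
  forall w, banded w A <->
    (forall j, L' j `<=` L (j + w%:Z)) /\ (forall i, L i `<=` L' (i + w%:Z)).
Proof.
move=> hL hL' hA h w; split=> [bA|[h1 h2]].
  split.
    by apply: rel_pos_band h _ => // i j ij; apply/eqP; apply: contraT => /bA; lia.
  apply: rel_pos_band (rel_pos_tr h) _ => // i j ij.
  by apply/eqP; apply: contraT => /bA; lia.
move=> i j; apply: contraNT => ij; apply/eqP.
case: (leP i j) => hij.
  by apply: (band_rel_pos hL' hL (rel_pos_tr h) h2); lia.
by apply: (band_rel_pos hL hL' h h1); lia.
Qed.

(** Bands add under composition, so only finitely many C occur. *)
Lemma schur_finite A B : Theta_r r A -> Theta_r r B ->
  finite_set [set C | Theta_r r C /\ p A B C != 0].
Proof.
move=> hA hB; have [w bA] := Theta_r_banded n0 hA; have [v bB] := Theta_r_banded n0 hB.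
apply: sub_finite_set (finite_banded r n0 (w + v)) => C /= [hC pC]; split=> //.
have [f [g [_ eC]]] := lmat_exists n0 hC; move: hC pC; rewrite eC => hC pC.
have [F [L' [hL' h1 h2]]] := schur_poly_neq0 hA hB pC.
have ff := sflag_flag F n0 f; have fg := sflag_flag F n0 g.
have [a1 a2] := (rel_pos_banded ff hL' hA h1 w).1 bA.
have [b1 b2] := (rel_pos_banded hL' fg hB h2 v).1 bB.
apply/(rel_pos_banded ff fg hC (sflag_rel_pos F n0 f g)); split=> j x.
  by move=> /b1 /a1; rewrite (_ : j + v%:Z + w%:Z = j + (w + v)%N%:Z) //; lia.
by move=> /a2 /b2; rewrite (_ : j + w%:Z + v%:Z = j + (w + v)%N%:Z) //; lia.
Qed.

(** An intermediate flag of upper triangular position from L and lower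
    triangular position to L'' lies in their intersection, which is standard. *)
Lemma between_sub (F : fieldType) f g f' g' L' :
  between (sflag n (F := F) f') (sflag n g')
    (lmat n f (lmax f g)) (lmat n (lmax f g) g) L' ->
  forall i, L' i `<=` sflag n (lmax f' g') i.
Proof.
move=> [hL' h1 h2] i x hx; rewrite -sflag_cap //; split.
  apply: (rel_pos_upper n0 (sflag_flag F n0 f') hL' h1) hx => a b.
  exact: lmat_maxr_lower.
apply: (rel_pos_upper n0 (sflag_flag F n0 g') hL' (rel_pos_tr h2)) hx => a b.
exact: lmat_maxl_upper.
Qed.

(** For w large, the sum over 0 <= J < n of the dimensions of L_J / (L_J meet L''_J):
    the measure of the triangular induction. *)
Definition total_corner (w : nat) A : nat := (\sum_(j < n) corner w A j%:Z)%N.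

(** L_J / L'_J has the dimension prescribed by the part of lmat f g above the
    diagonal, and it surjects onto L_J / (L_J meet L''_J). *)
Lemma between_corner (F : fieldType) f g f' g' L' :
  between (sflag n (F := F) f') (sflag n g')
    (lmat n f (lmax f g)) (lmat n (lmax f g) g) L' ->
  exists w0 : nat, forall w, (w0 <= w)%N ->
    (forall J, corner w (lmat n f' g') J <= corner w (lmat n f g) J)%N /\
    ((forall J, 0 <= J < n%:Z -> corner w (lmat n f' g') J = corner w (lmat n f g) J) ->
     L' = sflag n (lmax f' g')).
Proof.
move=> hb; have sub := between_sub hb; case: hb => hL' h1 _.
have ff := sflag_flag F n0 f'; have fm := sflag_flag F n0 (lmax f' g').
have corner_max w u v J : corner w (lmat n u (lmax u v)) J = corner w (lmat n u v) J.
  apply: eq_bigr => a _; apply: eq_bigr => b _.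
  by apply: lmat_maxr_upper; lia.
have max_sub i : sflag n (F := F) (lmax f' g') i `<=` sflag n f' i.
  by rewrite -sflag_cap // => x [].
have [w0 hw0] := corner_mono n0 ff hL' fm sub max_sub h1 (sflag_rel_pos F n0 _ _).
exists w0 => w /hw0[le_c eq_c]; split=> [J|e]; first by have := le_c J; rewrite !corner_max.
by apply: eq_c => J hJ; rewrite !corner_max e.
Qed.

(** Equal codimensions force the intermediate flag to be the intersection. *)
Lemma schur_tri_diag f g :
  p (lmat n f (lmax f g)) (lmat n (lmax f g) g) (lmat n f g) = 1.
Proof.
apply: (schur_poly_const (c := 1)) => [||F k]; try exact: lmat_Theta_r.
apply: (has_card1 (x := sflag n (lmax f g))); apply/seteqP; split=> L'.
  by move=> /between_corner[w0 /(_ w0 (leqnn _))[_]]; apply.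
by move=> ->; split; [apply: sflag_flag | apply: sflag_rel_pos | apply: sflag_rel_pos].
Qed.

(** If no dimension drops, the intermediate flag is the intersection again; then
    its positions X and Y are those attached to C, and they determine C. *)
Lemma schur_tri_lower f g C : Theta_r r C ->
  p (lmat n f (lmax f g)) (lmat n (lmax f g) g) C != 0 -> C != lmat n f g ->
  exists w0 : nat, forall w, (w0 <= w)%N ->
    (total_corner w C < total_corner w (lmat n f g))%N.
Proof.
move=> hC + CA; have [f' [g' [_ eC]]] := lmat_exists n0 hC; move: CA; rewrite eC => CA.
move=> /schur_poly_neq0[||F [L' hL']]; try exact: lmat_Theta_r.
have [w0 hw0] := between_corner hL'; exists w0 => w /hw0[le_c eq_c].
rewrite ltnNge; apply: contraNN CA => le_tot; apply/eqP.
have eL : L' = sflag n (lmax f' g').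
  apply: eq_c => J hJ; have hj : (absz J < n)%N by lia.
  apply/eqP; rewrite eqn_leq le_c leqNgt; apply/negP => lt_c.
  move: le_tot; apply/negP; rewrite -ltnNge /total_corner.
  rewrite (bigD1 (Ordinal hj)) //= [X in (_ < X)%N](bigD1 (Ordinal hj)) //=.
  rewrite -addSn; apply: leq_add; last by apply: leq_sum => j _; apply: le_c.
  by rewrite (_ : Posz (absz J) = J) //; lia.
have ff := sflag_flag F n0 f'; have fg := sflag_flag F n0 g'.
have fm := sflag_flag F n0 (lmax f' g').
case: hL' => _; rewrite eL => h1 h2; apply/esym/lmat_max_inj.
  exact: rel_pos_inj ff fm h1 (sflag_rel_pos F n0 _ _).
exact: rel_pos_inj fm fg h2 (sflag_rel_pos F n0 _ _).
Qed.

(** Both sides are the codimension of the same intersection; any field will do. *)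
Lemma total_corner_stable f g : exists w0 : nat, forall w, (w0 <= w)%N ->
  total_corner w (lmat n f g) = total_corner w0 (lmat n f g).
Proof.
have ff := sflag_flag rat n0 f; have fg := sflag_flag rat n0 g.
have [w0 hw0] := flag_commensurable n0 ff fg; exists w0 => w hw.
apply: eq_bigr => j _.
have q v : (w0 <= v)%N -> qdim (sflag n f j%:Z : set (vecs rat r))
    (meet (sflag n f) (sflag n g) j%:Z j%:Z) (corner v (lmat n f g) j%:Z).
  move=> hv; apply: rel_pos_corner => //; first exact: sflag_rel_pos.
  by move=> i x /hw0 hx; apply: (flag_le fg _ hx); lia.
apply: qdim_inj (q _ hw) (q _ (leqnn _)); first exact: flag_subspace ff.
exact: (meet_subspace _ _ ff fg).
Qed.

End SchurPolynomials.

(** * Finite sums and weights *)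

Lemma fsbig_finsupp (T : choiceType) (R : nmodType) (P Q : set T) (f : T -> R) :
  finite_set Q -> Q `<=` P -> (forall i, P i -> f i != 0 -> Q i) ->
  \sum_(i \in P) f i = \sum_(i <- fset_set Q) f i.
Proof.
move=> fQ QP h; apply: fsbig_superset; rewrite ?fset_uniq //= => i.
  by rewrite in_fset_set // inE; apply: QP.
by move=> Pi fi; rewrite in_fset_set // inE; apply: h.
Qed.

Lemma sigma_add n (A B : Theta n) : sigma (Theta_add A B) = (sigma A + sigma B)%N.
Proof.
rewrite /sigma -big_split; apply: eq_bigr => i _ /=.
have fin (M : Theta n) : finite_set [set j | M i%:Z j != 0] by case: (thetaP M).
pose D : set int := [set j | A i%:Z j != 0] `|` [set j | B i%:Z j != 0].
have fD : finite_set D by rewrite finite_setU.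
rewrite !(fsbig_finsupp (Q := D)) // -?big_split //.
- by move=> j _ h; right.
- by move=> j _ h; left.
- by move=> j _ /=; rewrite addn_eq0 negb_and => /orP.
Qed.

Section Weights.
Variables n r : nat.
Hypothesis n0 : (0 < n)%N.

(** The labels of a diagonal matrix agree. *)
Lemma Lambda_dg (l : Nseq n) : Lambda r l ->
  exists f : 'I_r -> int, (forall k, 1 <= f k <= n%:Z) /\ l = dg n f.
Proof.
move=> /diag_Theta_r /(lmat_exists n0)[f [g [hf e]]]; exists f; split=> //.
have fg : f = g.
  apply: funext => k; have := lmat_label n f g k; rewrite -e /=.
  by case: (eqVneq (f k) (g k)).
by apply: Theta_diag_inj; rewrite e -fg lmat_diag.
Qed.

Lemma finite_Lambda : finite_set (@Lambda n r).
Proof.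
pose lab (x : {ffun 'I_r -> 'I_n.+1}) : Nseq n := dg n (fun k => (x k : nat)%:Z).
apply: (@sub_finite_set _ _ (lab @` setT)); last exact: finite_image.
move=> l /Lambda_dg[f [hf ->]]; exists [ffun k => inord (absz (f k))] => //.
congr dg; apply: funext => k; rewrite ffunE inordK; have := hf k; lia.
Qed.

Lemma Lambda_le (l m : Nseq n) : Lambda r l -> Lambda r m ->
  (forall i : nat, (1 <= i <= n)%N -> (l i%:Z <= m i%:Z)%N) -> l = m.
Proof.
move=> hl hm le_lm; apply: Nseq_eq => i.
have [a [t [a1 an ->]]] := residue_exists i n0; rewrite !Nseq_shift.
have := hm; rewrite /Lambda /= -[X in _ = X]hl => e.
have ain : a \in index_iota 1 n.+1 by rewrite mem_index_iota a1 ltnS.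
move: e; rewrite (bigD1_seq a) ?iota_uniq //= [RHS](bigD1_seq a) ?iota_uniq //= => e.
have : (\sum_(1 <= i < n.+1 | i != a) l i%:Z <= \sum_(1 <= i < n.+1 | i != a) m i%:Z)%N.
  rewrite big_seq_cond [X in (_ <= X)%N]big_seq_cond; apply: leq_sum => b.
  by rewrite mem_index_iota ltnS => /andP[/le_lm].
have := le_lm a; rewrite a1 an => /(_ isT); lia.
Qed.

End Weights.

(** Also for x < m, where the falling factorial and one of the factors vanish. *)
Lemma ffact_prod (R : pzRingType) (x m : nat) :
  \prod_(0 <= k < m) (x%:R - k%:R) = (x ^_ m)%:R :> R.
Proof.
elim: m => [|m IH]; first by rewrite big_geq.
rewrite big_nat_recr //= IH ffactnSr natrM.
case: (leqP m x) => mx; first by rewrite natrB.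
by rewrite ffact_small // !mul0r.
Qed.

(** * The affine Schur algebra at v = 1 *)

Section SchurAtOne.
Variables n r : nat.
Hypothesis n0 : (0 < n)%N.
Variable p : Theta n -> Theta n -> Theta n -> {poly int}.
Hypothesis hp : is_schur_poly r p.
Variables (bS : algType Qv) (e : Theta n -> bS).
Hypothesis he : is_schur_alg r p e.
Variables (S : algType Zv) (br : Theta n -> S) (incl : {rmorphism S -> bS}).
Hypothesis hS : is_integral_form r e br incl.
Variables (SQ : algType rat) (tS : {rmorphism S -> SQ}).
Hypothesis tS_semilinear : semilinear_along spec1Q tS.
Implicit Types (A B C : Theta n) (f g h : 'I_r -> int) (l : Nseq n).

Definition supp A B : seq (Theta n) := fset_set [set C | Theta_r r C /\ p A B C != 0].

Lemma mem_supp A B C : Theta_r r A -> Theta_r r B ->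
  (C \in supp A B) <-> (Theta_r r C /\ p A B C != 0).
Proof.
by move=> hA hB; rewrite in_fset_set ?inE //; apply: schur_finite.
Qed.

Lemma lvalM (a b : Zv) : lval (a * b) = lval a * lval b.
Proof. by []. Qed.

(** The powers of v relating [A] to e_A enter only through units of the Laurent
    ring, which become 1 at v = 1. *)
Lemma br_mul A B : Theta_r r A -> Theta_r r B ->
  br A * br B = \sum_(C <- supp A B)
    (lvarz int ((dA C)%:Z - (dA A)%:Z - (dA B)%:Z) * poly_v2 (p A B C) : Zv) *: br C.
Proof.
move=> hA hB; case: hS => incl_inj inclZ inclE _; apply: incl_inj.
rewrite rmorphM !inclE // /brQv -scalerAl -scalerAr scalerA.
case: he => _ -> //.
rewrite (fsbig_finsupp (Q := [set C | Theta_r r C /\ p A B C != 0])); first last.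
- move=> C hC h0; split=> //; apply: contraNneq h0 => ->.
  by rewrite /poly_v2 comp_poly0 /= tofrac0 scale0r.
- by move=> C [].
- exact: schur_finite.
rewrite (rmorph_sum incl) scaler_sumr big_seq [RHS]big_seq; apply: eq_bigr => C.
move=> /(mem_supp _ hA hB)[hC _].
rewrite [RHS]inclZ inclE // /brQv !scalerA; congr (_ *: _).
rewrite -!lvalM [in RHS]mulrAC -!lvarzD.
by congr (lval (lvarz int _ * _)); lia.
Qed.

Definition br1 A : SQ := tS (br A).

Lemma br1_mul A B : Theta_r r A -> Theta_r r B ->
  br1 A * br1 B = \sum_(C <- supp A B) br1 C *~ (p A B C).[1].
Proof.
move=> hA hB; rewrite /br1 -rmorphM br_mul // (rmorph_sum tS); apply: eq_bigr => C _.
rewrite [LHS]tS_semilinear -scaler_int; congr (_ *: _).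
rewrite [LHS]/((ev1 _)%:~R) rmorphM /= ev1_lvarz mul1r ev1_lpoly.
by rewrite horner_comp hornerXn expr1n.
Qed.

(** Extracts a product whose structure constants are concentrated on C0; products
    with an idempotent on either side are of this kind. *)
Lemma br1_mul_single A B C0 (c : bool) : Theta_r r A -> Theta_r r B -> Theta_r r C0 ->
  (forall C, Theta_r r C -> p A B C = (c && (C == C0))%:Z%:P) ->
  br1 A * br1 B = if c then br1 C0 else 0.
Proof.
move=> hA hB hC0 pE; rewrite br1_mul //; case: c pE => pE; last first.
  rewrite big1_seq // => C /andP[_ /(mem_supp _ hA hB)[hC]].
  by rewrite pE // polyC0 eqxx.
rewrite (bigD1_seq C0) ?fset_uniq //=; last first.
  by apply/mem_supp => //; rewrite pE // eqxx oner_eq0.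
rewrite pE // eqxx hornerC mulr1z big1_seq ?addr0 // => C /andP[hC].
by move=> /(mem_supp _ hA hB)[hC' _]; rewrite pE // (negbTE hC) hornerC mulr0z.
Qed.

Lemma br1_diag_l l f g : Lambda r l ->
  br1 (Theta_diag l) * br1 (lmat n f g) = if l == dg n f then br1 (lmat n f g) else 0.
Proof.
move=> hl; have hM := lmat_Theta_r n0 f g; have hD := diag_Theta_r hl.
apply: br1_mul_single => // C /(lmat_exists n0)[f' [g' [_ ->]]].
rewrite (schur_diag_l n0 hp) //.
case: (eqVneq (lmat n f g) (lmat n f' g')) => [eM|_]; last by rewrite !andbF.
rewrite !andbT; congr (nat_of_bool (_ == _))%:Z%:P.
by apply: Nseq_eq => i; rewrite -(lmat_row n f' g') -(lmat_row n f g) eM.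
Qed.

Lemma br1_diag_r l f g : Lambda r l ->
  br1 (lmat n f g) * br1 (Theta_diag l) = if l == dg n g then br1 (lmat n f g) else 0.
Proof.
move=> hl; have hM := lmat_Theta_r n0 f g; have hD := diag_Theta_r hl.
apply: br1_mul_single => // C /(lmat_exists n0)[f' [g' [_ ->]]].
rewrite (schur_diag_r n0 hp) //.
case: (eqVneq (lmat n f g) (lmat n f' g')) => [eM|_]; last by rewrite !andbF.
rewrite !andbT; congr (nat_of_bool (_ == _))%:Z%:P.
apply: Nseq_eq => i; rewrite -(lmat_row n g' f') -(lmat_row n g f).
by rewrite -(lmat_tr n f g) eM lmat_tr.
Qed.

Lemma tS_span (x : S) : exists (D : seq (Theta n)) (c : Theta n -> int),
  (forall C, C \in D -> Theta_r r C) /\ tS x = \sum_(C <- D) br1 C *~ c C.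
Proof.
case: hS => _ _ _ /(_ x)[c fc ->].
exists (fset_set (Theta_r r `&` [set C | c C != 0])), (fun C => ev1 (c C)); split.
  by move=> C; rewrite in_fset_set // inE => -[].
rewrite (fsbig_finsupp fc); [|by move=> C []|]; last first.
  by move=> C hC h0; split=> //; apply: contraNneq h0 => ->; rewrite scale0r.
rewrite rmorph_sum; apply: eq_bigr => C _.
by rewrite [LHS]tS_semilinear -scaler_int.
Qed.

(** The element acting on the weight l by the scalar F l; products of such
    elements are computed pointwise. *)
Definition weight_sum (F : Nseq n -> rat) : SQ :=
  \sum_(l <- fset_set (@Lambda n r)) F l *: br1 (Theta_diag l).

Lemma mem_Lambda l : (l \in (fset_set (@Lambda n r) : seq _)) = (l \in @Lambda n r).
Proof. by rewrite in_fset_set //; apply: finite_Lambda. Qed.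

Lemma weight_sum_mul F f g :
  weight_sum F * br1 (lmat n f g) = F (dg n f) *: br1 (lmat n f g).
Proof.
rewrite mulr_suml (bigD1_seq (dg n f)) ?fset_uniq //=; last first.
  by rewrite mem_Lambda inE; apply: dg_Lambda.
rewrite -scalerAl br1_diag_l; last exact: dg_Lambda.
rewrite eqxx big1_seq ?addr0 // => l /andP[hl]; rewrite mem_Lambda inE => hl'.
by rewrite -scalerAl br1_diag_l // (negbTE hl) scaler0.
Qed.

Lemma weight_sumM F G :
  weight_sum F * weight_sum G = weight_sum (fun l => F l * G l).
Proof.
rewrite [X in _ * X]/weight_sum mulr_sumr big_seq [RHS]big_seq; apply: eq_bigr => l.
rewrite mem_Lambda inE => /(Lambda_dg n0)[f [_ ->]].
by rewrite -lmat_diag -scalerAr weight_sum_mul scalerA mulrC.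
Qed.

Lemma weight_sumB F G :
  weight_sum F - weight_sum G = weight_sum (fun l => F l - G l).
Proof. by rewrite -sumrB; apply: eq_bigr => l _; rewrite scalerBl. Qed.

Lemma weight_sumZ (c : rat) F : c *: weight_sum F = weight_sum (fun l => c * F l).
Proof. by rewrite scaler_sumr; apply: eq_bigr => l _; rewrite scalerA. Qed.

(** It acts as the identity on the span of the basis elements, which contains 1. *)
Lemma weight_sum1 : weight_sum (fun=> 1) = 1.
Proof.
have act x : weight_sum (fun=> 1) * tS x = tS x.
  have [D [c [hD ->]]] := tS_span x; rewrite mulr_sumr big_seq [RHS]big_seq.
  apply: eq_bigr => C /hD /(lmat_exists n0)[f [g [_ ->]]].
  by rewrite mulrzAr weight_sum_mul scale1r.
by have := act 1; rewrite rmorph1 mulr1.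
Qed.

Lemma weight_sum_prod (s : seq nat) (F : nat -> Nseq n -> rat) :
  \prod_(k <- s) weight_sum (F k) = weight_sum (fun l => \prod_(k <- s) F k l).
Proof.
elim: s => [|k s IH].
  by rewrite big_nil -weight_sum1; apply: eq_bigr => l _; rewrite big_nil.
by rewrite big_cons IH weight_sumM; apply: eq_bigr => l _; rewrite big_cons.
Qed.

Lemma weight_sum_binom (m : nat) (F : Nseq n -> nat) :
  binomU (weight_sum (fun l => (F l)%:R)) m = weight_sum (fun l => 'C(F l, m)%:R).
Proof.
rewrite /binomU; under eq_bigr => k _.
  have -> : k%:R = weight_sum (fun=> k%:R) :> SQ.
    rewrite -[LHS]scaler_nat -weight_sum1 weight_sumZ.
    by apply: eq_bigr => l _; rewrite mulr1.
  rewrite weight_sumB; over.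
rewrite weight_sum_prod weight_sumZ; apply: eq_bigr => l _; congr (_ *: _).
rewrite ffact_prod -bin_ffact natrM mulrC mulfK //.
by rewrite pnatr_eq0 -lt0n fact_gt0.
Qed.

(** The only weight m of size r with binomials (m_i choose l_i) all nonzero is l. *)
Lemma weight_sum_delta l : Lambda r l ->
  weight_sum (fun m => \prod_(1 <= i < n.+1) 'C(m i%:Z, l i%:Z)%:R) = br1 (Theta_diag l).
Proof.
move=> hl; rewrite /weight_sum (bigD1_seq l) ?fset_uniq //=; last first.
  by rewrite mem_Lambda inE.
rewrite big1 ?scale1r; last by move=> i _; rewrite binn.
rewrite big1_seq ?addr0 // => m /andP[ml]; rewrite mem_Lambda inE => hm.
suff [i hi lt_i] : exists2 i, i \in index_iota 1 n.+1 & (m i%:Z < l i%:Z)%N.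
  by rewrite (bigD1_seq i) ?iota_uniq //= bin_small // mul0r scale0r.
apply: contrapT => h; move/eqP: ml; apply; apply/esym/(Lambda_le n0 hl hm) => i hi.
rewrite leqNgt; apply/negP => lt_i; apply: h; exists i => //.
by rewrite mem_index_iota ltnS.
Qed.

Lemma A0r_sum Z l0 : Theta_r r (Theta_add Z (Theta_diag l0)) ->
  exists D : seq (Nseq n), [/\ uniq D, l0 \in D,
    forall l, l \in D -> Theta_r r (Theta_add Z (Theta_diag l))
    & tS (A0r r br Z) = \sum_(l <- D) br1 (Theta_add Z (Theta_diag l))].
Proof.
rewrite /Theta_r /= sigma_add sigma_diag => hs.
have fL := finite_Lambda (r - sigma Z) n0.
exists (fset_set (@Lambda n (r - sigma Z))); split.
- exact: fset_uniq.
- by rewrite in_fset_set // inE /Lambda /=; lia.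
- by move=> l; rewrite in_fset_set // inE sigma_add sigma_diag /Lambda /=; lia.
by rewrite /A0r ifT ?fsbig_finite ?(rmorph_sum tS) //; lia.
Qed.

(** Multiplying Z(0, r) by the idempotent of weight dg h keeps the one summand
    with that column sum, because the off-diagonal part is that of Z. *)
Lemma A0r_diag_r Z l0 f h : Theta_add Z (Theta_diag l0) = lmat n f h ->
  tS (A0r r br Z) * br1 (Theta_diag (dg n h)) = br1 (lmat n f h).
Proof.
move=> eZ; have dL := dg_Lambda n0 h.
have [|D [uD l0D hD ->]] := @A0r_sum Z l0; first by rewrite eZ; apply: lmat_Theta_r.
rewrite mulr_suml (bigD1_seq l0) //= eZ br1_diag_r // eqxx big1_seq ?addr0 //.
move=> l /andP[ll0 /hD /(lmat_exists n0)[f' [g' [_ eZ']]]].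
rewrite eZ' br1_diag_r //; case: eqP => // ehg.
case/eqP: ll0; apply: Theta_diag_inj.
have eT : lmat n g' f' = lmat n h f.
  apply: lmat_offdiag_inj => // i j ij.
  rewrite -(lmat_tr n f') -(lmat_tr n f) -eZ -eZ' /=.
  by rewrite eq_sym (negbTE ij).
move: eT; rewrite -(lmat_tr n f') -(lmat_tr n f) -eZ -eZ' => eT.
apply: Theta_eq => i j.
by have := congr1 (fun M : Theta n => M j i) eT => /= /addnI.
Qed.

Lemma A0r_diag_l Z l0 h g : Theta_add Z (Theta_diag l0) = lmat n h g ->
  br1 (Theta_diag (dg n h)) * tS (A0r r br Z) = br1 (lmat n h g).
Proof.
move=> eZ; have dL := dg_Lambda n0 h.
have [|D [uD l0D hD ->]] := @A0r_sum Z l0; first by rewrite eZ; apply: lmat_Theta_r.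
rewrite mulr_sumr (bigD1_seq l0) //= eZ br1_diag_l // eqxx big1_seq ?addr0 //.
move=> l /andP[ll0 /hD /(lmat_exists n0)[f' [g' [_ eZ']]]].
rewrite eZ' br1_diag_l //; case: eqP => // ehg.
case/eqP: ll0; apply: Theta_diag_inj.
have eT : lmat n f' g' = lmat n h g.
  by apply: lmat_offdiag_inj => // i j ij; rewrite -eZ -eZ' /= (negbTE ij).
move: eT; rewrite -eZ -eZ' => eT; apply: Theta_eq => i j.
by have := congr1 (fun M : Theta n => M i j) eT => /= /addnI.
Qed.

End SchurAtOne.

(** * Surjectivity by triangularity *)

Section UpperPart.
Variable n : nat.
Implicit Types (A : Theta n).

Lemma upper_subproof (A : Theta n) :
  periodic_band n (fun i j : int => if i < j then A i j else 0%N).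
Proof.
case: (thetaP A) => pA rA cA; split.
- by move=> i j; rewrite ltrD2r -pA.
- by move=> i; apply: sub_finite_set (rA i) => j /=; case: ifP.
- by move=> j; apply: sub_finite_set (cA j) => i /=; case: ifP.
Qed.

Definition upper (A : Theta n) : Theta n := MkTheta (upper_subproof A).

Lemma upper_plus A : Theta_plus (upper A).
Proof. by move=> i j ij /=; rewrite ltNge ij. Qed.

Lemma diagonal_subproof (A : Theta n) (i : int) : A i i = A (i - n%:Z) (i - n%:Z).
Proof. by case: (thetaP A) => pA _ _; rewrite [RHS]pA subrK. Qed.

Definition diagonal (A : Theta n) : Nseq n := MkNseq (diagonal_subproof A).

Lemma upper_split A : (forall i j, j < i -> A i j = 0%N) ->
  Theta_add (upper A) (Theta_diag (diagonal A)) = A.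
Proof.
move=> A0; apply: Theta_eq => i j /=.
by case: (ltgtP i j) => [|/A0 ->|->] //=; rewrite addn0.
Qed.

Lemma lower_split A : (forall i j, i < j -> A i j = 0%N) ->
  Theta_add (Theta_tr (upper (Theta_tr A))) (Theta_diag (diagonal A)) = A.
Proof.
move=> A0; apply: Theta_eq => i j /=.
by case: (ltgtP i j) => [/A0 ->||->] //=; rewrite addn0.
Qed.

End UpperPart.

Section Subgroup.
Variables (M : zmodType) (G : set M).
Hypothesis (G0 : G 0) (GB : forall x y, G x -> G y -> G (x - y)).

Lemma subgroupD x y : G x -> G y -> G (x + y).
Proof.
by move=> hx hy; rewrite -[y]opprK; apply: GB => //; rewrite -sub0r; apply: GB.
Qed.

Lemma subgroupMz x (c : int) : G x -> G (x *~ c).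
Proof.
move=> hx; have nat_mul m : G (x *+ m).
  by elim: m => [|m IH]; [rewrite mulr0n | rewrite mulrS; apply: subgroupD].
case: c => m; first exact: nat_mul.
by rewrite NegzE mulrNz -sub0r; apply: GB => //; apply: nat_mul.
Qed.

End Subgroup.

Section Surjectivity.
Variables n r : nat.
Hypothesis n0 : (0 < n)%N.
Variable p : Theta n -> Theta n -> Theta n -> {poly int}.
Hypothesis hp : is_schur_poly r p.
Variables (bS : algType Qv) (e : Theta n -> bS).
Hypothesis he : is_schur_alg r p e.
Variables (S : algType Zv) (br : Theta n -> S) (incl : {rmorphism S -> bS}).
Hypothesis hS : is_integral_form r e br incl.
Variables (SQ : algType rat) (tS : {rmorphism S -> SQ}).
Hypothesis tS_semilinear : semilinear_along spec1Q tS.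
Variables (U : algType rat) (iota : loop n -> U) (wp wm : Theta n -> U).
Variable eta : {lrmorphism U -> SQ}.
Hypothesis heta : is_eta iota r wp wm br tS eta.
Local Notation br1 := (br1 br tS).

Lemma eta_Eii i : eta (iota (loop_of (Etri n i i))) =
  weight_sum r br tS (fun l => (l i)%:R).
Proof.
by case: heta => _ -> _ _ _; rewrite fsbig_finite //; apply: finite_Lambda.
Qed.

Lemma eta_binom (l : Nseq n) :
  eta (\prod_(1 <= i < n.+1) binomU (iota (loop_of (Etri n i%:Z i%:Z))) (l i%:Z)) =
  weight_sum r br tS (fun m => \prod_(1 <= i < n.+1) 'C(m i%:Z, l i%:Z)%:R).
Proof.
rewrite rmorph_prod -(weight_sum_prod n0 hp he hS tS_semilinear).
apply: eq_bigr => i _.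
rewrite -(weight_sum_binom n0 hp he hS tS_semilinear) -eta_Eii.
rewrite /binomU [LHS](linearZZ eta) rmorph_prod.
by congr (_ *: _); apply: eq_bigr => k _; rewrite rmorphB rmorph_nat.
Qed.

Lemma S_Z0 : S_Z tS 0. Proof. exact: zspan0. Qed.

Lemma S_ZB x y : S_Z tS x -> S_Z tS y -> S_Z tS (x - y).
Proof. exact: zspanB. Qed.

Lemma S_ZM x y : S_Z tS x -> S_Z tS y -> S_Z tS (x * y).
Proof.
apply: zspanM => _ _ [u _ <-] [v _ <-].
by exists (u * v) => //; rewrite rmorphM.
Qed.

Lemma S_ZD x y : S_Z tS x -> S_Z tS y -> S_Z tS (x + y).
Proof. exact: subgroupD S_Z0 S_ZB x y. Qed.

Lemma S_Z_tens (x : S) : S_Z tS (tS x).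
Proof. by apply: zspan_gen; exists x. Qed.

Lemma S_Z_MZ x c : S_Z tS x -> S_Z tS (x *~ c).
Proof. exact: subgroupMz S_Z0 S_ZB x c. Qed.

(** The elements of U_Z go to the integral form: the images of w_A are sums of
    basis elements, and those of binomials have natural numbers as coefficients
    on the idempotents. *)
Lemma eta_U_Z x : U_Z iota wp wm x -> S_Z tS (eta x).
Proof.
case: heta => _ _ _ eta_wp eta_wm [m [c [g [hg ->]]]].
rewrite (rmorph_sum eta); apply: (big_ind (S_Z tS)); [exact: S_Z0|exact: S_ZD|move=> k _].
rewrite (rmorphMz eta); apply: S_Z_MZ; have [A [B [l [hA hB ->]]]] := hg k.
rewrite !(rmorphM eta); apply: S_ZM; last by rewrite [X in S_Z _ X]eta_wm //; apply: S_Z_tens.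
apply: S_ZM; first by rewrite [X in S_Z _ X]eta_wp //; apply: S_Z_tens.
rewrite [X in S_Z _ X]eta_binom.
apply: (big_ind (S_Z tS)); [exact: S_Z0|exact: S_ZD|move=> m' _].
rewrite -natr_prod scaler_nat pmulrn; apply: S_Z_MZ; exact: S_Z_tens.
Qed.

Lemma S_Z_span y : S_Z tS y -> exists (D : seq (Theta n)) (c : Theta n -> int),
  (forall C, C \in D -> Theta_r r C) /\ y = \sum_(C <- D) br1 C *~ c C.
Proof.
move=> [m [c [g [hg ->]]]].
have [x hx] : exists x : S, \sum_(k < m) g k *~ c k = tS x.
  have /choice[u hu] : forall k, exists u, tS u = g k.
    by move=> k; have [u _ hu] := hg k; exists u.
  exists (\sum_k u k *~ c k); rewrite rmorph_sum; apply: eq_bigr => k _.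
  by rewrite rmorphMz hu.
by rewrite hx; apply: (tS_span hS tS_semilinear).
Qed.

Definition integral_image (y : SQ) := exists2 u, U_Z iota wp wm u & eta u = y.

Lemma integral_imageB y z : integral_image y -> integral_image z -> integral_image (y - z).
Proof.
move=> [u hu <-] [v hv <-]; exists (u - v); first exact: zspanB.
by rewrite rmorphB.
Qed.

Lemma integral_image0 : integral_image 0.
Proof. by exists 0; [apply: zspan0 | rewrite rmorph0]. Qed.

Lemma integral_imageD y z : integral_image y -> integral_image z -> integral_image (y + z).
Proof. exact: subgroupD integral_image0 integral_imageB y z. Qed.

Lemma integral_image_MZ y c : integral_image y -> integral_image (y *~ c).
Proof. exact: subgroupMz integral_image0 integral_imageB y c. Qed.

(** The idempotent of weight dg h, inserted between the sums attached to the two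
    strictly triangular parts, selects one summand on each side. *)
Lemma integral_image_tri (f g : 'I_r -> int) :
  integral_image (br1 (lmat n f (lmax f g)) * br1 (lmat n (lmax f g) g)).
Proof.
set h := lmax f g; case: heta => _ _ _ eta_wp eta_wm.
have hX := upper_split (A := lmat n f h) (fun i j => @lmat_maxr_lower n r f g i j).
have hY := lower_split (A := lmat n h g) (fun i j => @lmat_maxl_upper n r f g i j).
exists (wp (upper (lmat n f h)) *
  (\prod_(1 <= i < n.+1) binomU (iota (loop_of (Etri n i%:Z i%:Z))) (dg n h i%:Z)) *
  wm (upper (Theta_tr (lmat n h g)))).
  apply: zspan_gen; exists (upper (lmat n f h)), (upper (Theta_tr (lmat n h g))), (dg n h).
  by split=> //; apply: upper_plus.
have dL := dg_Lambda n0 h.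
rewrite !(rmorphM eta) [X in X * _ * _ = _]eta_wp; last exact: upper_plus.
rewrite [X in _ * _ * X = _]eta_wm; last exact: upper_plus.
rewrite [X in _ * X * _ = _]eta_binom (weight_sum_delta n0 _ _ dL).
rewrite (A0r_diag_r n0 hp he hS tS_semilinear hX).
rewrite -[X in X * _](_ : br1 (lmat n f h) * br1 (Theta_diag (dg n h)) = _); last first.
  by rewrite (br1_diag_r n0 hp he hS tS_semilinear) // eqxx.
by rewrite -mulrA (A0r_diag_l n0 hp he hS tS_semilinear hY).
Qed.

(** Triangular induction on the stable value of total_corner. *)
Lemma integral_image_basis C : Theta_r r C -> integral_image (br1 C).
Proof.
have main N : forall C, Theta_r r C -> (exists w0 : nat, forall w, (w0 <= w)%N ->
    (total_corner w C < N)%N) -> integral_image (br1 C).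
  elim: N => [|N IH] {}C hC [w0 hw0]; first by have := hw0 w0 (leqnn _).
  have [f [g [_ eC]]] := lmat_exists n0 hC; rewrite eC in hC hw0 *.
  set X := lmat n f (lmax f g); set Y := lmat n (lmax f g) g.
  have hX : Theta_r r X by apply: lmat_Theta_r.
  have hY : Theta_r r Y by apply: lmat_Theta_r.
  have pXY : p X Y (lmat n f g) = 1 := schur_tri_diag n0 hp f g.
  have := integral_image_tri f g; rewrite -/X -/Y (br1_mul n0 hp he hS tS_semilinear hX hY).
  rewrite (bigD1_seq (lmat n f g)) ?fset_uniq //=; last first.
    by apply/(mem_supp n0 hp) => //; rewrite pXY oner_eq0.
  rewrite pXY hornerC mulr1z => himg.
  rewrite -[br1 _](addrK (\sum_(C' <- supp r p X Y | C' != lmat n f g)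
                            br1 C' *~ (p X Y C').[1])).
  apply: integral_imageB => //; rewrite big_seq_cond; apply: (big_ind integral_image).
  - exact: integral_image0.
  - exact: integral_imageD.
  move=> C' /andP[/(mem_supp n0 hp _ hX hY)[hC' pC'] nC'].
  apply: integral_image_MZ; apply: IH => //.
  have [w1 hw1] := schur_tri_lower n0 hp hC' pC' nC'.
  exists (maxn w0 w1) => w; rewrite geq_max => /andP[/hw0 h0 /hw1 h1].
  exact: leq_trans h1 h0.
move=> hC; have [f [g [_ eC]]] := lmat_exists n0 hC.
have [w0 hw0] := total_corner_stable n0 f g.
apply: (main (total_corner w0 C).+1) => //; exists w0 => w /hw0.
by rewrite -eC => ->.
Qed.

Lemma eta_U_Z_surj y : S_Z tS y -> exists2 x, U_Z iota wp wm x & eta x = y.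
Proof.
move=> /S_Z_span[D [c [hD ->]]]; rewrite -/(integral_image _) big_seq.
apply: (big_ind integral_image); first exact: integral_image0.
  exact: integral_imageD.
move=> C /hD hC.
exact/integral_image_MZ/integral_image_basis.
Qed.

End Surjectivity.

(** * Restriction of a ring morphism to subrings *)

Section Restriction.
Variables (R R' : nzRingType) (P : subring R) (P' : subring R') (eta : {rmorphism R -> R'}).
Hypothesis eta_sub : forall x : P, eta (sr_val x) \in subring_pred P'.

Definition subring_restrict (x : P) : P' := SubringElt (eta_sub x).

Lemma subring_restrict_is_zmod : zmod_morphism subring_restrict.
Proof.
move=> x y; apply: val_inj; rewrite /= -[RHS]/(eta (sr_val x) - eta (sr_val y)).
by rewrite -rmorphB.
Qed.

Lemma subring_restrict_is_monoid : monoid_morphism subring_restrict.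
Proof.
split; first by apply: val_inj; rewrite /= -[LHS]/(eta 1) rmorph1.
move=> x y; apply: val_inj; rewrite /= -[RHS]/(eta (sr_val x) * eta (sr_val y)).
by rewrite -rmorphM.
Qed.

HB.instance Definition _ :=
  GRing.isZmodMorphism.Build _ _ subring_restrict subring_restrict_is_zmod.
HB.instance Definition _ :=
  GRing.isMonoidMorphism.Build _ _ subring_restrict subring_restrict_is_monoid.

Definition subring_restrict_morphism : {rmorphism P -> P'} := subring_restrict.

End Restriction.

Theorem theorem6p7 (n : nat) (hn : (2 <= n)%N)
  (phi : Theta n -> Theta n -> Theta n -> {poly int}) (hphi : is_hall_poly phi)
  (Dp : algType Zv) (up : Theta n -> Dp) (hDp : is_hall_alg_plus phi up)
  (Dm : algType Zv) (um : Theta n -> Dm) (hDm : is_hall_alg_minus phi um)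
  (DpQ : algType rat) (tp : {rmorphism Dp -> DpQ}) (htp : is_base_change spec1Q tp)
  (DmQ : algType rat) (tm : {rmorphism Dm -> DmQ}) (htm : is_base_change spec1Q tm)
  (U : algType rat) (iota : {linear loop n -> U})
  (hU : is_enveloping (@loop_br n) iota)
  (thp : {lrmorphism DpQ -> U}) (hthp : is_theta_plus iota up tp thp)
  (thm : {lrmorphism DmQ -> U}) (hthm : is_theta_minus iota um tm thm)
  (hUZ : subring_closed
     [pred x | `[< U_Z iota (fun A => thp (tp (up A))) (fun A => thm (tm (um A))) x >]])
  (r : nat)
  (p : Theta n -> Theta n -> Theta n -> {poly int}) (hp : is_schur_poly r p)
  (bS : algType Qv) (e : Theta n -> bS) (he : is_schur_alg r p e)
  (S : algType Zv) (br : Theta n -> S) (incl : {rmorphism S -> bS})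
  (hS : is_integral_form r e br incl)
  (SQ : algType rat) (tS : {rmorphism S -> SQ}) (htS : is_base_change spec1Q tS)
  (eta : {lrmorphism U -> SQ})
  (heta : is_eta iota r (fun A => thp (tp (up A))) (fun A => thm (tm (um A))) br tS eta) :
  exists f : {rmorphism Subring hUZ -> Subring (S_Z_subring tS)},
    (forall x, sr_val (f x) = eta (sr_val x)) /\ (forall y, exists x, f x = y).
Proof.
have n0 : (0 < n)%N by apply: leq_trans hn.
have [tS_semi _] := htS.
have into (x : Subring hUZ) : eta (sr_val x) \in subring_pred (Subring (S_Z_subring tS)).
  case: x => x /= /asboolP hx; apply/asboolP.
  exact: (eta_U_Z n0 hp he hS tS_semi heta hx).
exists (subring_restrict_morphism into); split=> // -[y hy].
have /asboolP hy' := hy.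
have [x hx ex] := eta_U_Z_surj n0 hp he hS tS_semi heta hy'.
have hx' : x \in subring_pred (Subring hUZ) by apply/asboolP.
by exists (SubringElt hx'); apply: val_inj.
Qed.
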